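(* Let $\alpha=\sqrt{2}\sum_{k=2}^{\infty}\frac{\sqrt{\log k}-\sqrt{\log(k-1)}}{k}\approx 0.8482$. There is an absolute constant $c>0$ such that for every $\epsilon>0$ there exists $N_\epsilon$ such that if $n>N_\epsilon$, then $2^{[n]}$ can be partitioned into $\binom{n}{\lfloor n/2\rfloor}$ rank-symmetric chains, each of size between $(\alpha-\epsilon)\sqrt{n}$ and $c\sqrt{n}/\epsilon$. In particular, if $n$ is sufficiently large, there is a partition of $2^{[n]}$ into $\binom{n}{\lfloor n/2\rfloor}$ rank-symmetric chains each of size between $0.8\sqrt{n}$ and $13\sqrt{n}$.
   Context: $2^{[n]}$ is the power set of $[n]=\{1,\dots,n\}$ ordered by inclusion. A chain $c_0\subset\dots\subset c_k$ in $2^{[n]}$ is rank-symmetric if $|c_i|+|c_{k-i}|=n$ for $i=0,\dots,k$. The size of a chain is its number of elements.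
   Formalization: The range ''for every ε>0'' is restricted to 0<ε<α: with an absolute c, the claim fails for ε≥c, since the average chain size 2^n/C(n,⌊n/2⌋) exceeds √n; the approximate value 0.8482 of α is not asserted. *)

(* Defs.v *)
From HB Require Import structures.
From mathcomp Require Import all_boot all_order all_algebra.
From mathcomp Require Import all_classical all_reals all_analysis.
Import Order.TTheory GRing.Theory Num.Theory.
Import numFieldNormedType.Exports.

Set Implicit Arguments.
Unset Strict Implicit.
Unset Printing Implicit Defensive.

Local Open Scope ring_scope.

(* The ground set [n] = {1, ..., n} is represented by 'I_n, and 2^[n] by
   {set 'I_n}.  A chain with k+1 elements is enumerated by 'I_k.+1, on which
   rev_ord is i |-> k - i. *)
Definition rank_symmetric_chain (n : nat) (C : {set {set 'I_n}}) : Prop :=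
  exists (k : nat) (c : 'I_k.+1 -> {set 'I_n}),
    [/\ C = [set c i | i : 'I_k.+1]%SET,
        forall i j : 'I_k.+1, (i < j)%N -> c i \proper c j
      & forall i : 'I_k.+1, (#|c i| + #|c (rev_ord i)|)%N = n].

(* The k-th term is O(1 / (k^2 sqrt(log k))), so the series converges and the
   total operator limn denotes its sum. *)
Definition alpha (R : realType) : R :=
  Num.sqrt 2 *
  limn (fun m : nat => \sum_(2 <= k < m)
    (Num.sqrt (ln k%:R) - Num.sqrt (ln (k%:R - 1))) / k%:R : R).

(* Main.v *)
(* Read a subset x of [n] with 2|x| >= n around a circle, matching every absent
   element, like an opening bracket, with a present one; 2|x| - n elements of x
   stay unmatched.  Let p(x) be the set of matched elements.  Then p is a
   bijection from the upper half of 2^[n] onto the lower half, with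
   |p(x)| = n - |x|, and if C is a chain for the order "x <= y iff x is included
   in y and p(y) in p(x)", then the union of p(C) and C is a rank-symmetric
   chain.  This order has the normalized matching property: sending (x, z), z not
   in x, to the set obtained from x by adding the element that opens the
   outermost bracket around z hits every y at most |y| times.

   For any poset with normalized matching, layers of sizes N = N_0 >= N_1 >= ...
   can be laid out as consecutive intervals on a line, and Hall's condition holds
   for the relation that links two layers when a translation by N takes a point of
   the first to a point of the second.  This gives N chains which meet every run
   of consecutive layers of total size >= N and have O(2^n / N) elements.  The
   layers of size >= N / k reach up to sqrt (n ln k / 2), so each chain meets
   sqrt (n / 2) * (sqrt (ln k) - sqrt (ln (k - 1))) / k runs of k layers of size
   between N / k and N / (k - 1); summing over k gives alpha. *)

Require Import Defs.
From HB Require Import structures.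
From mathcomp Require Import all_boot all_order all_algebra.
From mathcomp Require Import zify.
Import Order.TTheory GRing.Theory Num.Theory.

Set Implicit Arguments.
Unset Strict Implicit.
Unset Printing Implicit Defensive.

Local Open Scope ring_scope.

(** * The matching around the circle *)

Definition step (c : bool) : int := if c then 1 else -1.

Fixpoint walk (b : nat -> bool) (t : nat) : int :=
  if t is s.+1 then walk b s + step (b s) else 0.

Fixpoint wmax (b : nat -> bool) (t : nat) : int :=
  if t is s.+1 then Num.max (wmax b s) (walk b t) else 0.

Fixpoint last_argmax (b : nat -> bool) (t : nat) : nat :=
  if t is s.+1 then if wmax b s <= walk b t then t else last_argmax b s else 0%N.

(** A step up is a closing bracket; a record is one that no earlier opening bracket matches. It is
    indexed by its step, from time [s] to [s.+1]. *)
Definition record (b : nat -> bool) (s : nat) : bool := wmax b s < walk b s.+1.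

Arguments walk : simpl never.
Arguments wmax : simpl never.
Arguments last_argmax : simpl never.

Lemma walkS b t : walk b t.+1 = walk b t + step (b t).
Proof. by []. Qed.

Lemma wmaxS b t : wmax b t.+1 = Num.max (wmax b t) (walk b t.+1).
Proof. by []. Qed.

Lemma walk_le_wmax b s t : (t <= s)%N -> walk b t <= wmax b s.
Proof.
elim: s => [|s IHs]; first by rewrite leqn0 => /eqP ->.
rewrite leq_eqVlt ltnS wmaxS le_max => /orP[/eqP -> | /IHs ->] //.
by rewrite lexx orbT.
Qed.

Lemma wmax_le b s (h : int) :
  (forall t, (t <= s)%N -> walk b t <= h) -> wmax b s <= h.
Proof.
elim: s => [|s IHs] hle; first exact: (hle 0%N).
rewrite wmaxS ge_max IHs ?hle // => t ts; apply: hle; exact: leqW.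
Qed.

Lemma wmax_mono b s t : (s <= t)%N -> wmax b s <= wmax b t.
Proof. by move=> st; apply: wmax_le => u us; apply: walk_le_wmax; apply: leq_trans st. Qed.

Lemma wmax_record b s : wmax b s.+1 = wmax b s + (record b s)%:R.
Proof.
rewrite wmaxS /record walkS; have := walk_le_wmax b (leqnn s).
by rewrite /step; case: (b s); case: ltP; lia.
Qed.

Lemma record_step b s : record b s -> b s /\ walk b s = wmax b s.
Proof.
rewrite /record walkS; have := walk_le_wmax b (leqnn s).
by rewrite /step; case: (b s); lia.
Qed.

Lemma recordP b s :
  reflect (forall t, (t <= s)%N -> walk b t < walk b s.+1) (record b s).
Proof.
apply: (iffP idP) => [rs t ts|h].
  by apply: le_lt_trans rs; apply: walk_le_wmax.
have : wmax b s <= walk b s.+1 - 1 by apply: wmax_le => t /h; lia.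
by rewrite /record; lia.
Qed.

Lemma last_argmaxS b s :
  last_argmax b s.+1 = if wmax b s <= walk b s.+1 then s.+1 else last_argmax b s.
Proof. by []. Qed.

Lemma last_argmax_le b s : (last_argmax b s <= s)%N.
Proof. by elim: s => // s IHs; rewrite last_argmaxS; case: ifP => // _; apply: leqW. Qed.

Lemma walk_last_argmax b s : walk b (last_argmax b s) = wmax b s.
Proof.
elim: s => [//|s IHs]; rewrite wmaxS last_argmaxS.
by case: (leP (wmax b s) (walk b s.+1)).
Qed.

Lemma last_argmax_lt b s t :
  (last_argmax b s < t)%N -> (t <= s)%N -> walk b t < wmax b s.
Proof.
elim: s => [|s IHs]; first by case: t.
rewrite wmaxS last_argmaxS; case: (leP (wmax b s) (walk b s.+1)) => [_|lt at_ ts].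
  by lia.
by move: ts; rewrite leq_eqVlt ltnS => /orP[/eqP -> |/(IHs at_)].
Qed.

Lemma walk_mono (b c : nat -> bool) s t : (forall u, b u -> c u) -> (s <= t)%N ->
  walk b t - walk b s <= walk c t - walk c s.
Proof.
move=> bc; elim: t => [|t IHt]; first by rewrite leqn0 => /eqP ->; lia.
rewrite leq_eqVlt ltnS => /orP[/eqP -> |/IHt]; first by lia.
by rewrite !walkS /step; have := bc t; case: (b t); case: (c t); lia.
Qed.

(** A record only bounds the increments ending at [s.+1] from below, and these grow with the
    word. *)
Lemma record_mono (b c : nat -> bool) s : (forall u, b u -> c u) -> record b s -> record c s.
Proof.
move=> bc /recordP rs; apply/recordP => t ts.
by have := rs t ts; have := walk_mono bc (leqW ts); lia.
Qed.

Lemma walk_agree b c s t :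
  (forall u, (s <= u < t)%N -> b u = c u) -> (s <= t)%N ->
  walk b t - walk b s = walk c t - walk c s.
Proof.
move=> bc; elim: t bc => [|t IHt] bc; first by rewrite leqn0 => /eqP ->; lia.
rewrite leq_eqVlt ltnS => /orP[/eqP -> |st]; first by lia.
rewrite !walkS bc ?st ?ltnSn // -addrAC (IHt _ st); first by lia.
by move=> u /andP[su ut]; apply: bc; rewrite su ltnW.
Qed.

(** * Periodic walks with nonnegative drift *)

Section Periodic.

Variables (b : nat -> bool) (n : nat).
Hypothesis b_periodic : forall t, b (t + n)%N = b t.

Lemma walk_periodic t : walk b (t + n) = walk b t + walk b n.
Proof. by elim: t => [|t IHt]; rewrite ?add0n ?add0r // addSn !walkS b_periodic IHt; lia. Qed.

Hypothesis drift_ge0 : 0 <= walk b n.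

(** Times before [n] are not shifts of earlier ones, but they are at most [t] and the drift is
    nonnegative. This is why one full turn is run first. *)
Lemma wmax_periodic t : (n <= t)%N -> wmax b (t + n) = wmax b t + walk b n.
Proof.
move=> nt; apply/eqP; rewrite eq_le; apply/andP; split.
  apply: wmax_le => s st; case: (leqP n s) => ns.
    have -> : s = (s - n + n)%N by lia.
    by rewrite walk_periodic lerD2r; apply: walk_le_wmax; lia.
  by have : walk b s <= wmax b t by [apply: walk_le_wmax; lia]; lia.
rewrite -lerBrDr; apply: wmax_le => s st; rewrite lerBrDr -walk_periodic.
by apply: walk_le_wmax; lia.
Qed.

Lemma record_periodic s : (n <= s)%N -> record b (s + n) = record b s.
Proof. by move=> ns; rewrite /record -addSn wmax_periodic // walk_periodic; lia. Qed.

Lemma sum_record_wmax k : \sum_(i < k) (record b (n + i))%:R = wmax b (n + k) - wmax b n.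
Proof.
elim: k => [|k IHk]; first by rewrite big_ord0 addn0 subrr.
by rewrite big_ord_recr /= IHk addnS wmax_record; lia.
Qed.

Lemma sum_record : \sum_(i < n) (record b (n + i))%:R = walk b n.
Proof. by rewrite sum_record_wmax wmax_periodic //; lia. Qed.

(** Otherwise a value at least as high would recur one turn later, still by time [s]. *)
Lemma last_argmax_gt s : (0 < n)%N -> (s < last_argmax b s + n)%N.
Proof.
move=> n_gt0; rewrite ltnNge; apply/negP => h.
have := last_argmax_lt (b := b) (t := (last_argmax b s + n)%N) _ h.
by rewrite walk_periodic walk_last_argmax => /(_ ltac:(lia)); lia.
Qed.

(* Just before the first record after time t, 2 wmax - walk takes the value
   wmax b t, which by [pitman_ge] is its minimum over all times s >= t. *)
Lemma pitman_attained t : 0 < walk b n -> (n <= t)%N ->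
  exists2 s, (t <= s)%N & 2 * wmax b s - walk b s = wmax b t.
Proof.
(* A turn raises the maximum by the positive drift, so a next record exists; minimality of [k] picks
   the first one. *)
move=> d_gt0 nt; have ex : exists k, wmax b t < wmax b (t + k.+1).
  by exists n.-1; case: n d_gt0 nt (wmax_periodic nt) => // k; rewrite /=; lia.
case: (ex_minnP ex) => k hk mink; exists (t + k)%N; first by lia.
have eq : wmax b (t + k) = wmax b t.
  apply/eqP; rewrite eq_le (wmax_mono _ (leq_addr _ _)) andbT leNgt.
  by apply/negP; case: k hk mink => [|k] hk mink; rewrite ?addn0 ?ltxx // => /mink; lia.
move: hk; rewrite addnS wmax_record eq; case: (boolP (record _ _)) => [/record_step[_ ->]|]; last by lia.
by rewrite eq; lia.
Qed.

End Periodic.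

Lemma pitman_ge b s t : (t <= s)%N -> wmax b t <= 2 * wmax b s - walk b s.
Proof. by move=> ts; have := wmax_mono b ts; have := walk_le_wmax b (leqnn s); lia. Qed.

(** * Matched and unmatched elements of a subset *)

Section Unmatched.

Variable n : nat.
Implicit Types x y : {set 'I_n.+1}.

(** [inZp] reduces modulo [n.+1], so the word reads [x] turn after turn. *)
Definition cyc_word x (s : nat) : bool := inZp s \in x.

(* The positions of x left unmatched when, around the circle, each absent
   element is matched like an opening bracket with a present one.  The second
   turn [n+1, 2n+2) of the walk represents the circle. *)
Definition unmatched x : {set 'I_n.+1} :=
  [set i : 'I_n.+1 | record (cyc_word x) (n.+1 + i)].

(** On heavy sets, this is the bijection $p$ onto the lower half. *)
Definition matched x : {set 'I_n.+1} := x :\: unmatched x.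

Lemma inZp_ord (i : 'I_n.+1) : inZp i = i.
Proof. by apply: val_inj; rewrite /= modn_small. Qed.

Lemma inZpDn s : inZp (s + n.+1) = inZp s :> 'I_n.+1.
Proof. by apply: val_inj; rewrite /= modnDr. Qed.

Lemma inZpnD s : inZp (n.+1 + s) = inZp s :> 'I_n.+1.
Proof. by rewrite addnC inZpDn. Qed.

Lemma cyc_word_periodic x s : cyc_word x (s + n.+1) = cyc_word x s.
Proof. by rewrite /cyc_word inZpDn. Qed.

Lemma walk_sum b k : walk b k = \sum_(i < k) step (b i).
Proof. by elim: k => [|k IHk]; rewrite ?big_ord0 // big_ord_recr /= -IHk. Qed.

Lemma sum_step_card (T : finType) (A : {set T}) :
  \sum_(i : T) step (i \in A) = (2 * #|A|)%:Z - #|T|%:Z.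
Proof.
rewrite (bigID (mem A)) /= (eq_bigr (fun=> 1)); last by move=> i ->.
rewrite [X in _ + X](eq_bigr (fun=> -1)); last by move=> i /negbTE ->.
rewrite !sumr_const mulNrn !natz -(cardC (mem A)) PoszD.
have -> : #|[pred i | i \notin A]| = #|[predC (mem A)]| by apply: eq_card.
have -> : #|mem A| = #|A| by apply: eq_card.
by lia.
Qed.

Lemma walk_turn x : walk (cyc_word x) n.+1 = (2 * #|x|)%:Z - n.+1%:Z.
Proof.
rewrite walk_sum; have := sum_step_card x; rewrite card_ord => <-.
by apply: eq_bigr => i _; rewrite /cyc_word inZp_ord.
Qed.

Definition heavy x : bool := (n.+1 <= 2 * #|x|)%N.

Lemma walk_turn_ge0 x : heavy x -> 0 <= walk (cyc_word x) n.+1.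
Proof. by rewrite walk_turn /heavy; lia. Qed.

(** Records are periodic from the second turn on, so any later time can be brought back to the
    window that defines [unmatched]. *)
Lemma mem_unmatched x s : heavy x -> (n.+1 <= s)%N ->
  record (cyc_word x) s = (inZp s \in unmatched x).
Proof.
move=> hx; rewrite inE /=.
have [k ks] := ubnP s; elim: k s ks => // k IHk s ks ns.
case: (ltnP s (n.+1 + n.+1)) => sn.
  by congr record; have := @modn_small (s - n.+1) n.+1; rewrite -(modnDr (s - n.+1)) subnK //; lia.
have := IHk (s - n.+1)%N; rewrite -(modnDr (s - n.+1)) subnK; last by lia.
move=> <-; try lia.
rewrite -[in LHS](subnK (leq_trans (leqnSn n) ns : (n <= s)%N)).
have -> : (s - n + n = s - n.+1 + n.+1)%N by lia.
apply: record_periodic; last by lia.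
  exact: cyc_word_periodic.
exact: walk_turn_ge0.
Qed.

Lemma unmatched_sub x : unmatched x \subset x.
Proof.
apply/subsetP => i; rewrite inE => /record_step[].
by rewrite /cyc_word inZpnD inZp_ord.
Qed.

Lemma unmatched_mono x y : x \subset y -> unmatched x \subset unmatched y.
Proof.
move=> /subsetP xy; apply/subsetP => i; rewrite !inE; apply: record_mono => u.
exact: xy.
Qed.

(** The second turn raises the maximum by exactly the drift, one record at a time. *)
Lemma card_unmatched x : heavy x -> (#|unmatched x| + n.+1 = 2 * #|x|)%N.
Proof.
move=> hx; have := sum_record (cyc_word_periodic x) (walk_turn_ge0 hx).
have -> : \sum_(i < n.+1) (record (cyc_word x) (n.+1 + i))%:R = #|unmatched x|%:Z.
  rewrite -sum1_card -natz natr_sum [RHS]big_mkcond /=.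
  by apply: eq_bigr => i _; rewrite inE; case: (record _ _).
by rewrite walk_turn; lia.
Qed.

Lemma card_matched x : heavy x -> (#|matched x| + #|x| = n.+1)%N.
Proof.
move=> hx; have := card_unmatched hx.
by have := cardsDS (unmatched_sub x); have := subset_leq_card (unmatched_sub x); rewrite /matched; lia.
Qed.

Lemma matched_sub x : matched x \subset x.
Proof. exact: subsetDl. Qed.

Lemma matchedU x : x = matched x :|: unmatched x.
Proof.
apply/setP => i; rewrite in_setU in_setD.
by have := subsetP (unmatched_sub x) i; case: (i \in unmatched x) => [->|]; rewrite ?orbF.
Qed.

(* Pitman's transform: walking along [matched x] follows walk - 2 wmax. *)
Lemma walk_matched x s t : heavy x -> (n.+1 <= s <= t)%N ->
  walk (cyc_word (matched x)) t - walk (cyc_word (matched x)) s =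
  (walk (cyc_word x) t - 2 * wmax (cyc_word x) t) -
  (walk (cyc_word x) s - 2 * wmax (cyc_word x) s).
Proof.
move=> hx /andP[ns]; elim: t => [|t IHt]; first by lia.
rewrite leq_eqVlt ltnS => /orP[/eqP <-|st]; first by lia.
have nt : (n.+1 <= t)%N by apply: leq_trans st.
rewrite wmax_record !walkS (mem_unmatched hx nt).
have -> : cyc_word (matched x) t = cyc_word x t && (inZp t \notin unmatched x).
  by rewrite /cyc_word /matched in_setD andbC.
have := IHt st; have := subsetP (unmatched_sub x) (inZp t).
by rewrite /cyc_word; case: (_ \in unmatched x) => [/(_ isT) ->|_]; last case: (_ \in x); rewrite /step /=; lia.
Qed.

(** By [walk_matched], the matched set determines 2 wmax - walk up to a constant [c]. The running
    maximum is the future minimum of that process, so it is also determined up to [c], and its jumps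
    are the unmatched elements. *)
Lemma matched_inj x y : heavy x -> #|x| = #|y| -> matched x = matched y -> x = y.
Proof.
move=> hx cxy mxy; have hy : heavy y by rewrite /heavy -cxy.
suff uxy : unmatched x = unmatched y by rewrite (matchedU x) mxy uxy -matchedU.
have := card_unmatched hx; have := card_unmatched hy.
(* Recovering the maximum requires positive drift; with zero drift nothing is unmatched. *)
have [c0 cy cx|c_gt0 _ cx] := posnP (2 * #|x| - n.+1)%N.
  rewrite (cards0_eq (A := unmatched x)); last by move: hx; rewrite /heavy; lia.
  by rewrite (cards0_eq (A := unmatched y)) //; move: hx; rewrite /heavy; lia.
pose m := wmax (cyc_word x); pose m' := wmax (cyc_word y).
pose w := walk (cyc_word x); pose w' := walk (cyc_word y).
pose c : int := (2 * m n.+1 - w n.+1) - (2 * m' n.+1 - w' n.+1).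
have Ec t : (n.+1 <= t)%N -> 2 * m t - w t = 2 * m' t - w' t + c.
  move=> nt; have := @walk_matched x n.+1 t hx; have := @walk_matched y n.+1 t hy.
  by rewrite mxy leqnn nt /= => /(_ isT) -> /(_ isT); rewrite /c /m /m' /w /w'; lia.
have dx : 0 < walk (cyc_word x) n.+1 by rewrite walk_turn; lia.
have dy : 0 < walk (cyc_word y) n.+1 by rewrite walk_turn; lia.
have Em t : (n.+1 <= t)%N -> m t = m' t + c.
  move=> nt; apply/eqP; rewrite eq_le; apply/andP; split.
    have [s ts es] := pitman_attained (cyc_word_periodic y) (ltW dy) dy nt.
    by have := pitman_ge (cyc_word x) ts; have := Ec s (leq_trans nt ts); rewrite /m /m' /w /w' in es *; lia.
  have [s ts es] := pitman_attained (cyc_word_periodic x) (ltW dx) dx nt.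
  by have := pitman_ge (cyc_word y) ts; have := Ec s (leq_trans nt ts); rewrite /m /m' /w /w' in es *; lia.
apply/setP => i; rewrite !inE.
have := wmax_record (cyc_word x) (n.+1 + i); have := wmax_record (cyc_word y) (n.+1 + i).
have := Em (n.+1 + i)%N (leq_addr _ _); have := Em (n.+1 + i).+1 (leqW (leq_addr _ _)).
by rewrite /m /m'; do 2 case: (record _ _); lia.
Qed.

(** The position where the walk last sits at its maximum up to [z]: the outermost opening bracket
    around [z], possibly [z] itself. *)
Definition partner x (z : 'I_n.+1) : 'I_n.+1 :=
  inZp (last_argmax (cyc_word x) (n.+1 + z)).

Lemma last_argmax_window x (z : 'I_n.+1) : heavy x ->
  (z < last_argmax (cyc_word x) (n.+1 + z) <= n.+1 + z)%N.
Proof.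
move=> hx; rewrite last_argmax_le andbT.
have := last_argmax_gt (cyc_word_periodic x) (walk_turn_ge0 hx) (n.+1 + z) isT.
by lia.
Qed.

(** The step after the last maximum goes down, unless the window ends there and the partner is
    [z]. *)
Lemma partner_notin x z : heavy x -> z \notin x -> partner x z \notin x.
Proof.
move=> hx zx; have /andP[_] := last_argmax_window z hx.
rewrite /partner; set a := last_argmax _ _; rewrite leq_eqVlt.
case/orP => [/eqP ->|az]; first by rewrite inZpnD inZp_ord.
have := last_argmax_lt (b := cyc_word x) (ltnSn a) az.
rewrite -walk_last_argmax -/a walkS -[_ \in x]/(cyc_word x a).
by case: (cyc_word x a); rewrite /step; lia.
Qed.

(** The walk is at its maximum when it reaches the partner, so turning that letter up creates a
    record. *)
Lemma partner_unmatched x z : heavy x -> z \notin x ->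
  partner x z \in unmatched (partner x z |: x).
Proof.
move=> hx zx; rewrite inE; apply/recordP => t.
have /andP[za az] := last_argmax_window z hx.
set p := partner x z; pose a := last_argmax (cyc_word x) (n.+1 + z).
(* [unmatched] inspects the copy [a'] of the partner in the second turn, while [a] may lie in the
   first. *)
have [a' ea' pa'] : exists2 a', a' = (n.+1 + p)%N & a' = a \/ a' = (a + n.+1)%N.
  exists (n.+1 + p)%N => //; rewrite /p /partner /= -/a.
  case: (ltnP a n.+1) => an; first by right; rewrite modn_small //; lia.
  left; have := @modn_small (a - n.+1) n.+1; rewrite -(modnDr (a - n.+1)) subnK //.
  by rewrite /a in an *; have := ltn_ord z; lia.
have max_a' s : (s <= a')%N -> walk (cyc_word x) s <= walk (cyc_word x) a'.
  have d0 := walk_turn_ge0 hx; have P := walk_periodic (cyc_word_periodic x).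
  have max_a u : (u <= n.+1 + z)%N -> walk (cyc_word x) u <= walk (cyc_word x) a.
    by rewrite /a walk_last_argmax; apply: walk_le_wmax.
  case: pa' => -> sa'; first by apply: max_a; rewrite /a in sa' *; lia.
  rewrite P; case: (leqP s (n.+1 + z)) => sz; first by have := max_a s sz; lia.
  have -> : s = (s - n.+1 + n.+1)%N by lia.
  by rewrite P lerD2r; apply: max_a; rewrite /a in sa' *; lia.
rewrite -ea' => ta'.
have := max_a' t ta'.
have sub u : cyc_word x u -> cyc_word (p |: x) u by rewrite /cyc_word inE orbC => ->.
have := walk_mono sub ta'; rewrite walkS.
have -> : cyc_word (p |: x) a' by rewrite /cyc_word ea' inZpnD inZp_ord setU11.
by rewrite /step; lia.
Qed.

Lemma inZp_inj_window (z u v : nat) : (z < u <= n.+1 + z)%N -> (z < v <= n.+1 + z)%N ->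
  inZp u = inZp v :> 'I_n.+1 -> u = v.
Proof.
wlog uv : u v / (u <= v)%N => [hw hu hv e|hu hv /(congr1 val) /= /eqP].
  by case: (leqP u v) => [|/ltnW] uv; [apply: hw | apply/esym/hw].
rewrite eq_sym eqn_mod_dvd // => /dvdnP[[|k]]; [lia|nia].
Qed.

(* If a < a' were both partners of z, then on (a, a'] the walk of [y :\ u]
   would have to climb back to its value at a. *)
Lemma partner_inj y (u v z : 'I_n.+1) : heavy (y :\ u) -> heavy (y :\ v) ->
  u \in y -> v \in y -> z \notin y ->
  partner (y :\ u) z = u -> partner (y :\ v) z = v -> u = v.
Proof.
pose arg w := last_argmax (cyc_word (y :\ w)) (n.+1 + z).
wlog aa' : u v / (arg u <= arg v)%N => [hw hu hv uy vy zy eu ev|].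
  by case: (leqP (arg u) (arg v)) => [|/ltnW] h; [exact: (hw u v) | apply/esym; exact: (hw v u)].
move: aa'; rewrite /arg => {arg}.
set xu := y :\ u; set xv := y :\ v => aa' hu hv uy vy zy; rewrite /partner.
set a := last_argmax _ _ in aa' *; set a' := last_argmax (cyc_word xv) _ in aa' * => eu ev.
have wa : (z < a <= n.+1 + z)%N := last_argmax_window z hu.
have wa' : (z < a' <= n.+1 + z)%N := last_argmax_window z hv.
move: aa'; rewrite leq_eqVlt => /orP[/eqP eaa|aa']; first by rewrite -eu -ev eaa.
exfalso.
(* At the end of the window [v] would be [z], which is outside [y]. *)
have a'z : (a' < n.+1 + z)%N.
  rewrite ltn_neqAle (andP wa').2 andbT; apply: contraNneq zy => ea'.
  by rewrite -[z]inZp_ord -inZpnD -ea' ev.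
(* The walk of [y :\ u] is below its maximum after [a]; that of [y :\ v] does not end lower at [a']
   than at [a.+1]. Both words agree in between, and [v] still makes the first walk step up at [a']:
   a contradiction. *)
have lt1 : walk (cyc_word xu) a'.+1 < walk (cyc_word xu) a.
  by rewrite [X in _ < X]walk_last_argmax; apply: last_argmax_lt => //; lia.
have le2 : walk (cyc_word xv) a.+1 <= walk (cyc_word xv) a'.
  by rewrite [X in _ <= X]walk_last_argmax; apply: walk_le_wmax; lia.
have agree w : (a.+1 <= w < a')%N -> cyc_word xu w = cyc_word xv w.
  move=> /andP[aw wa'']; rewrite /cyc_word !inE; congr (_ && _).
  have -> : (inZp w == u) = false.
    by apply/eqP; rewrite -eu => /(inZp_inj_window (z := z)) ; lia.
  by apply/esym/eqP; rewrite -ev => /(inZp_inj_window (z := z)); lia.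
have := walk_agree agree aa'.
have ca' : cyc_word xu a'.
  rewrite /cyc_word ev !inE vy andbT -eu -ev; apply/eqP => /(inZp_inj_window (z := z)); lia.
by move: lt1; rewrite !(walkS (cyc_word xu)) ca' /step; case: (cyc_word xu a); lia.
Qed.

Definition nested_le x y : bool := (x \subset y) && (matched y \subset matched x).

Lemma nested_le_refl : reflexive nested_le.
Proof. by move=> x; rewrite /nested_le !subxx. Qed.

Lemma nested_le_trans : transitive nested_le.
Proof.
move=> y x z /andP[xy yx] /andP[yz zy].
by rewrite /nested_le (subset_trans xy yz) (subset_trans zy yx).
Qed.

(** The new element is unmatched and older unmatched elements remain so by [unmatched_mono], hence
    nothing becomes matched. *)
Lemma nested_le_partner x z : heavy x -> z \notin x ->
  nested_le x (partner x z |: x).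
Proof.
move=> hx zx; rewrite /nested_le subsetUr /=.
have := partner_unmatched hx zx; have := subsetP (unmatched_mono (subsetUr [set partner x z] x)).
set p := partner x z => sub pu; apply/subsetP => i.
rewrite !in_setD in_setU1 => /andP[iu /orP[/eqP ip|->]].
  by rewrite ip pu in iu.
by rewrite andbT; apply: contra iu => /sub.
Qed.

(* Each y is reached from the pairs (x, z) with z among the elements outside y
   or unmatched in y, and z determines x. *)
Lemma card_partner_fiber (k : nat) y : #|y| = k.+1 -> (n.+1 <= 2 * k)%N ->
  (#|[set q : {set 'I_n.+1} * 'I_n.+1 |
      [&& #|q.1| == k, q.2 \notin q.1 & partner q.1 q.2 |: q.1 == y]]| <= k.+1)%N.
Proof.
move=> cy nk; set F := finset _.
have FP q : q \in F -> [/\ heavy q.1, q.2 \notin q.1, partner q.1 q.2 \in unmatched y,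
    partner q.1 q.2 \in y & q.1 = y :\ partner q.1 q.2].
  rewrite inE => /and3P[/eqP cq qz /eqP e]; have hq : heavy q.1 by rewrite /heavy cq.
  have pn := partner_notin hq qz; split=> //.
  - by rewrite -[X in unmatched X]e; apply: partner_unmatched.
  - by rewrite -e setU11.
  - by rewrite -e setU1K.
have inj2 : {in F &, injective snd}.
  case=> [x z] [x' z'] Fq Fq' /= ez; move: Fq'; rewrite -{z'}ez => Fq'.
  have [/= hx zx px py ex] := FP _ Fq; have [/= hx' zx' px' py' ex'] := FP _ Fq'.
  suff pp : partner x z = partner x' z by rewrite ex ex' pp.
  (* If [z] is in [y], then it is the only element missing from [x], hence the partner; otherwise
     [partner_inj] applies. *)
  case: (boolP (z \in y)) => zy.
    have p (w : {set _}) : z \notin w -> w = y :\ partner w z -> partner w z = z.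
      by move=> + ew; rewrite {1}ew !inE zy andbT negbK => /eqP.
    by rewrite (p x zx ex) (p x' zx' ex').
  have := @partner_inj y (partner x z) (partner x' z) z.
  by rewrite -ex -ex'; apply.
rewrite -(card_in_imset inj2).
have sub : snd @: F \subset unmatched y :|: ~: y.
  apply/subsetP => _ /imsetP[q Fq ->]; have [hq qz pu py eq] := FP _ Fq.
  rewrite in_setU in_setC; case: (boolP (q.2 \in y)) => zy; last by rewrite orbT.
  by move: qz; rewrite eq !inE zy andbT negbK => /eqP ->; rewrite inE in pu; rewrite pu.
apply: leq_trans (subset_leq_card sub) _; apply: leq_trans (leq_card_setU _ _) _.
have hy : heavy y by rewrite /heavy cy; lia.
(* The two parts have 2(k+1) - (n+1) and (n+1) - (k+1) elements, in total k+1. *)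
have := card_unmatched hy; have := cardsC y; rewrite card_ord cy.
by move: #|unmatched y| #|~: y| => a b; lia.
Qed.

(** Double counting of the pairs $(x, z)$: each [x] has [n.+1 - k] of them, each image receives at
    most [k.+1], and the ratio of these numbers is that of the two layer sizes. *)
Lemma nested_matching_step k (A : {set {set 'I_n.+1}}) :
  (n.+1 <= 2 * k)%N -> (forall x, x \in A -> #|x| = k) ->
  (#|A| * 'C(n.+1, k.+1) <=
   #|[set y : {set 'I_n.+1} | (#|y| == k.+1) && [exists x in A, nested_le x y]]|
     * 'C(n.+1, k))%N.
Proof.
move=> nk cA; set G := finset _.
pose Q := [set q : {set 'I_n.+1} * 'I_n.+1 | (q.1 \in A) && (q.2 \notin q.1)].
pose F (q : {set 'I_n.+1} * 'I_n.+1) := partner q.1 q.2 |: q.1.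
have FG q : q \in Q -> F q \in G.
  rewrite inE => /andP[qA qz]; have hq : heavy q.1 by rewrite /heavy (cA _ qA).
  rewrite inE cardsU1 (partner_notin hq qz) (cA _ qA) add1n eqxx /=.
  by apply/exists_inP; exists q.1 => //; apply: nested_le_partner.
have cQ : #|Q| = (#|A| * (n.+1 - k))%N.
  rewrite -sum1_card (eq_bigl (fun q => (q.1 \in A) && (q.2 \notin q.1))); last by move=> q; rewrite inE.
  rewrite -(pair_big_dep (mem A) (fun x z => z \notin x) (fun _ _ => 1%N)) /=.
  rewrite (eq_bigr (fun=> (n.+1 - k)%N)) ?sum_nat_const // => x xA.
  rewrite sum1_card; have := cardsC x; rewrite card_ord (cA _ xA) => e.
  suff -> : #|(fun i : 'I_n.+1 => i \notin x)| = #|~: x| by move: e; move: #|~: x| => c; lia.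
  by apply: eq_card => z; rewrite !inE.
have leQ : (#|Q| <= #|G| * k.+1)%N.
  rewrite -sum1_card (partition_big F (mem G)) //=.
  rewrite -sum_nat_const; apply: leq_sum => y; rewrite inE => /andP[/eqP cy _].
  apply: leq_trans (card_partner_fiber cy nk).
  rewrite sum1_card; apply: subset_leq_card; apply/subsetP => q; rewrite unfold_in.
  by rewrite !inE => /andP[/andP[/cA -> ->] ->]; rewrite eqxx.
have kn : ('C(n.+1, k.+1) * k.+1 = 'C(n.+1, k) * (n.+1 - k))%N.
  by rewrite mulnC mul_bin_left mulnC.
rewrite -(leq_pmul2r (ltn0Sn k)) -mulnA kn mulnCA -cQ.
by rewrite [leqRHS]mulnAC mulnC leq_mul2r leQ orbT.
Qed.

(** Single steps compose: multiply the inequalities and cancel the intermediate layer size. *)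
Lemma nested_matching k j (A : {set {set 'I_n.+1}}) :
  (n.+1 <= 2 * k)%N -> (k + j <= n.+1)%N -> (forall x, x \in A -> #|x| = k) ->
  (#|A| * 'C(n.+1, k + j) <=
   #|[set y : {set 'I_n.+1} | (#|y| == k + j)%N && [exists x in A, nested_le x y]]|
     * 'C(n.+1, k))%N.
Proof.
move=> nk; elim: j => [|j IHj] kj cA.
  rewrite addn0 leq_mul2r; apply/orP; right; apply: subset_leq_card.
  apply/subsetP => x xA; rewrite inE cA // eqxx /=.
  by apply/exists_inP; exists x => //; apply: nested_le_refl.
have {}IHj := IHj _ cA; move: IHj; set G := finset _ => IHj.
have cG x : x \in G -> #|x| = (k + j)%N by rewrite inE => /andP[/eqP].
have nkj : (n.+1 <= 2 * (k + j))%N by lia.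
have := nested_matching_step nkj cG.
set H := finset _; rewrite -addnS; set H' := finset _ => h.
have HH' : (#|H| <= #|H'|)%N.
  apply: subset_leq_card; apply/subsetP => y; rewrite !inE addnS => /andP[-> /=].
  case/exists_inP => x; rewrite inE => /andP[_ /exists_inP[w wA wx]] xy.
  by apply/exists_inP; exists w => //; apply: nested_le_trans xy.
have {}IHj := IHj ltac:(lia).
have c_gt0 : (0 < 'C(n.+1, k + j))%N by rewrite bin_gt0; lia.
rewrite -(leq_pmul2r c_gt0) mulnAC.
apply: leq_trans (leq_mul IHj (leqnn _)) _.
rewrite mulnAC [leqRHS]mulnAC leq_mul2r; apply/orP; right.
by apply: leq_trans h _; rewrite leq_mul2r HH' orbT.
Qed.

End Unmatched.

(** * Chain partitions of posets with normalized matching *)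

Section Hall.

Local Open Scope nat_scope.

Variables (T : finType) (e : rel T).
Implicit Types A B S : {set T}.

Definition nbhd S B : {set T} := [set y in B | [exists x in S, e x y]].

Lemma nbhdU S S' B : nbhd (S :|: S') B = nbhd S B :|: nbhd S' B.
Proof.
apply/setP => y; rewrite !inE -andb_orr; congr (_ && _).
apply/exists_inP/orP => [[x]|].
  by rewrite inE => /orP[xS|xS] exy; [left|right]; apply/exists_inP; exists x.
by case=> /exists_inP[x xS exy]; exists x; rewrite ?inE ?xS ?orbT.
Qed.

(** Induction on the size of [A]: a tight proper subset [S] splits the problem into [S] and its
    complement. *)
Lemma hall_marriage A B : (forall S, S \subset A -> #|S| <= #|nbhd S B|) ->
  exists f : T -> T,
    {in A &, injective f} /\ forall x, x \in A -> f x \in B /\ e x (f x).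
Proof.
have [k] := ubnP #|A|; elim: k A B => // k IHk A B Ak hall.
have [A0|[x0 x0A]] := set_0Vmem A.
  by exists id; split=> // x; rewrite A0 inE.
have [/existsP[S /and3P[SA S0 /eqP tight]]|] :=
  boolP [exists S : {set T}, [&& S \proper A, S != set0 & #|nbhd S B| == #|S|]].
  have [SsA ltSA] := (proper_sub SA, proper_card SA).
  have S_gt0 : 0 < #|S| by rewrite card_gt0.
  have cAS := cardsD A S; rewrite (setIidPr SsA) in cAS.
  have [||f1 [inj1 f1P]] := IHk S (nbhd S B); first by lia.
    move=> S' S'S; apply: leq_trans (hall S' (subset_trans S'S SsA)) _.
    apply/subset_leq_card/subsetP => y; rewrite !inE => /andP[-> h] /=; rewrite h andbT.
    by case/exists_inP: h => x xS' exy; apply/exists_inP; exists x => //; apply: (subsetP S'S).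
  have [||f2 [inj2 f2P]] := IHk (A :\: S) (B :\: nbhd S B); first by rewrite cAS; lia.
    move=> S' S'A; have disj : [disjoint S & S'].
      by rewrite disjoint_sym; apply: disjointWl S'A _; rewrite disjoints_subset subsetDr.
    have := hall (S :|: S'); rewrite subUset SsA (subset_trans S'A (subsetDl _ _)) => /(_ isT).
    rewrite cardsU (disjoint_setI0 disj) cards0 subn0 nbhdU => h.
    have sub : nbhd S B :|: nbhd S' B \subset nbhd S B :|: nbhd S' (B :\: nbhd S B).
      apply/subsetP => y; rewrite in_setU in_setU => /orP[->//|y'].
      case: (boolP (y \in nbhd S B)) => // yS /=.
      by move: y'; rewrite [in X in X -> _]inE inE in_setD yS.
    have := leq_trans (subset_leq_card sub) (leq_card_setU _ _); rewrite tight; lia.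
  have f12 x y : x \in S -> y \in A -> y \notin S -> f1 x <> f2 y.
    move=> xS yA yS exy; have [h1 _] := f1P _ xS.
    have [|h2 _] := f2P y; first by rewrite in_setD yS.
    by move: h2; rewrite in_setD -exy h1.
  exists (fun x => if x \in S then f1 x else f2 x); split=> [x y xA yA|x xA].
    case: (boolP (x \in S)) => xS; case: (boolP (y \in S)) => yS; first exact: inj1.
    - by move/(f12 _ _ xS yA yS).
    - by move/esym/(f12 _ _ yS xA xS).
    - by apply: inj2; rewrite in_setD ?xS ?yS.
  case: ifP => xS; first by have [+ ->] := f1P _ xS; rewrite inE => /andP[->].
  by have [] := f2P x _; rewrite ?inE ?xS // => /andP[_ ->].
(* No proper nonempty subset is tight, so each has a spare neighbour and [x0] may take any of its
   own. *)
move=> /existsPn slack.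
have : 0 < #|nbhd [set x0] B| by have := hall [set x0]; rewrite sub1set cards1 => /(_ x0A).
case/card_gt0P => y0; rewrite inE => /andP[y0B /exists_inP[_ /set1P-> ex0]].
have [||f [injf fP]] := IHk (A :\ x0) (B :\ y0).
- by have := cardsD1 x0 A; rewrite x0A; lia.
- move=> S SA; have [->|S0] := eqVneq S set0; first by rewrite cards0.
  have pS : S \proper A by apply: sub_proper_trans SA (properD1 x0A).
  have := slack S; rewrite pS S0 /= => ne; have := hall S (proper_sub pS).
  rewrite leq_eqVlt eq_sym (negbTE ne) /= => lt.
  have sub : nbhd S B \subset y0 |: nbhd S (B :\ y0).
    by apply/subsetP => y; rewrite !inE => /andP[-> ->]; case: eqP.
  by have := leq_trans (subset_leq_card sub) (leq_card_setU _ _); rewrite cards1; lia.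
exists (fun x => if x == x0 then y0 else f x); split=> [x y xA yA|x xA].
  have fy z : z \in A -> z != x0 -> f z != y0.
    by move=> zA zx; have [] := fP z _; rewrite ?inE ?zx // => /andP[].
  case: eqP => [->|/eqP xx]; case: eqP => [->//|/eqP yx].
  - by move=> /esym/eqP; rewrite (negbTE (fy _ yA yx)).
  - by move=> /eqP; rewrite (negbTE (fy _ xA xx)).
  - by apply: injf; rewrite in_setD1 ?xx ?yx.
case: eqP => [->//|/eqP xx].
by have [] := fP x _; rewrite ?inE ?xx // => /andP[_ ->].
Qed.

End Hall.

(** * Layers as consecutive intervals on a line *)

Section CyclicLayout.

Local Open Scope nat_scope.

Variable w : nat -> nat.

Definition prefix (i : nat) : nat := \sum_(j < i) w j.

(** Index of the interval containing the point [v], searched downwards from [k]. *)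
Fixpoint level_at (k v : nat) : nat :=
  if k is k'.+1 then if prefix k <= v then k else level_at k' v else 0.

Lemma prefix0 : prefix 0 = 0.
Proof. by rewrite /prefix big_ord0. Qed.

Lemma prefixS i : prefix i.+1 = prefix i + w i.
Proof. by rewrite /prefix big_ord_recr. Qed.

Lemma prefix_mono i j : i <= j -> prefix i <= prefix j.
Proof.
elim: j => [|j IHj]; first by rewrite leqn0 => /eqP ->.
by rewrite leq_eqVlt ltnS => /orP[/eqP ->|/IHj h] //; rewrite prefixS; lia.
Qed.

Lemma level_at_le k v : level_at k v <= k.
Proof. by elim: k => //= k IHk; case: ifP => // _; apply: leqW. Qed.

Lemma level_atP k v : v < prefix k.+1 ->
  prefix (level_at k v) <= v < prefix (level_at k v).+1.
Proof.
elim: k => [|k IHk] vk; first by rewrite /= prefix0.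
by rewrite /=; case: (leqP (prefix k.+1) v) => [->|/IHk].
Qed.

Lemma level_at_uniq k j v : j <= k -> prefix j <= v < prefix j.+1 -> level_at k v = j.
Proof.
elim: k => [|k IHk]; first by rewrite leqn0 => /eqP ->.
rewrite leq_eqVlt ltnS => /orP[/eqP -> /andP[h _]|jk /andP[jv vj]]; first by rewrite /= h.
rewrite /= leqNgt (leq_trans vj) ?(prefix_mono (leqW jk)) //=; last exact: prefix_mono.
by apply: IHk => //; rewrite jv.
Qed.

Local Open Scope ring_scope.

(** Turns a weighted sum over layers into a sum over points, which can be compared under a
    translation. *)
Lemma sum_level_at (F : nat -> rat) R k : (k <= R.+1)%N ->
  \sum_(0 <= v < prefix k) F (level_at R v) = \sum_(j < k) (w j)%:R * F j.
Proof.
elim: k => [|k IHk] kR; first by rewrite prefix0 big_geq // big_ord0.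
rewrite (@big_cat_nat _ _ _ (prefix k)) //=; last by rewrite prefixS leq_addr.
rewrite IHk ?big_ord_recr //=; last by lia.
congr (_ + _); rewrite big_nat (eq_bigr (fun=> F k)) => [|v vk]; last first.
  by rewrite (level_at_uniq (j := k)).
by rewrite -big_nat sumr_const_nat prefixS addKn mulr_natl.
Qed.

End CyclicLayout.

(** * Chains obtained from a translation of the line *)

Section ChainPartition.

Local Open Scope nat_scope.

Variables (T : finType) (rk : T -> nat) (R : nat) (le : rel T).

Definition layer (i : nat) : {set T} := [set x | rk x == i].
Definition width (i : nat) : nat := #|layer i|.

Hypothesis rk_le : forall x, rk x <= R.
Hypothesis width_gt0 : forall i, i <= R -> 0 < width i.
Hypothesis width_le0 : forall i, width i <= width 0.
Hypothesis ple_refl : reflexive le.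
Hypothesis ple_trans : transitive le.
Hypothesis normalized_matching : forall i j (A : {set T}), i < j -> j <= R ->
  (forall x, x \in A -> rk x = i) ->
  #|A| * width j <= #|[set y | (rk y == j) && [exists x in A, le x y]]| * width i.

Let N := width 0.
Let S := prefix width.

(* With the layers laid out consecutively on a line as intervals of length
   [width i], a translation by N takes a point of the i-th interval into the
   j-th one. *)
Definition linked (i j : nat) : bool := (S j < S i.+1 + N) && (S i + N < S j.+1).

(* What the translation moves beyond the end of the line comes back to layer 0. *)
Definition next (x y : T) : bool :=
  if rk y == 0 then S R.+1 < S (rk x).+1 + N else le x y && linked (rk x) (rk y).

(** No interval is longer than [N], so the translation leaves the one it starts in. *)
Lemma linked_lt i j : linked i j -> i < j.
Proof.
case/andP=> _ h; rewrite ltnNge; apply/negP => ji.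
have := prefix_mono width (ji : j.+1 <= i.+1); rewrite (prefixS width i) -/S.
by have := width_le0 i; rewrite -/N; lia.
Qed.

Lemma card_by_layer (A : {set T}) : #|A| = \sum_(i < R.+1) #|A :&: layer i|.
Proof.
rewrite -sum1_card (partition_big (fun x => inord (rk x) : 'I_R.+1) xpredT) //=.
apply: eq_bigr => i _; rewrite -sum1_card; apply: eq_bigl => x.
by rewrite !inE -val_eqE /= inordK // ltnS.
Qed.

Local Open Scope ring_scope.

Let density (A : {set T}) (i : nat) : rat := #|A :&: layer i|%:R / (width i)%:R.

(** The cardinality as an integral over the line, each point carrying the density of its layer. *)
Lemma card_density (A : {set T}) :
  #|A|%:R = \sum_(0 <= v < S R.+1) density A (level_at width R v).
Proof.
rewrite sum_level_at // card_by_layer natr_sum; apply: eq_bigr => i _.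
by rewrite /density mulrC divfK // pnatr_eq0 -lt0n width_gt0 // -ltnS.
Qed.

Lemma density_le1 A i : (i <= R)%N -> density A i <= 1.
Proof.
move=> iR; rewrite ler_pdivrMr ?ltr0n ?width_gt0 // mul1r ler_nat.
exact/subset_leq_card/subsetIr.
Qed.

Lemma density_ge0 A i : 0 <= density A i.
Proof. by rewrite divr_ge0 // ler0n. Qed.

(** Normalized matching divided by both widths; [0 < j] avoids the wrap-around branch of [next]. *)
Lemma density_linked A i j : (0 < j <= R)%N -> linked i j ->
  density A i <= density (nbhd next A setT) j.
Proof.
move=> /andP[j0 jR] lij; have ij := linked_lt lij.
have iR : (i <= R)%N by lia.
rewrite ler_pdivrMr ?ltr0n ?width_gt0 // mulrAC ler_pdivlMr ?ltr0n ?width_gt0 //.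
rewrite -!natrM ler_nat.
have rkA x : x \in A :&: layer i -> rk x = i by rewrite !inE => /andP[_ /eqP].
apply: leq_trans (normalized_matching ij jR rkA) _.
rewrite leq_mul2r; apply/orP; right; apply/subset_leq_card/subsetP => y.
rewrite !inE /= => /andP[/eqP rj /exists_inP[x]]; rewrite !inE => /andP[xA /eqP ri] xy.
rewrite rj eqxx andbT; apply/exists_inP; exists x => //.
by rewrite /next rj ri xy lij; case: eqP j0 => // ->.
Qed.

(** The wrap-around reaches all of layer 0, whose density becomes 1 as soon as [A] meets layer
    [i]. *)
Lemma density_end A i : (i <= R)%N -> (S R.+1 < S i.+1 + N)%N ->
  density A i <= density (nbhd next A setT) 0.
Proof.
move=> iR iend; have [e|[x]] := set_0Vmem (A :&: layer i).
  by rewrite {1}/density e cards0 mul0r density_ge0.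
rewrite !inE => /andP[xA /eqP ri].
apply: le_trans (density_le1 _ iR) _; rewrite {1}/density.
suff -> : nbhd next A setT :&: layer 0 = layer 0.
  by rewrite divff // pnatr_eq0 -lt0n width_gt0.
apply/setIidPr/subsetP => y; rewrite !inE /= => /eqP ry.
by apply/exists_inP; exists x => //; rewrite /next ry ri.
Qed.

(** The two integrals compare pointwise: the points below [D] move up by [N], and the last [N]
    points are paired with layer 0, which fills the first [N]. *)
Lemma next_hall (A : {set T}) : (#|A| <= #|nbhd next A setT|)%N.
Proof.
set G := nbhd _ _ _; rewrite -(ler_nat rat) !card_density.
have NS : (N <= S R.+1)%N by have := prefix_mono width (isT : 0 < R.+1)%N; rewrite prefixS prefix0.
set D := (S R.+1 - N)%N.
rewrite (@big_cat_nat _ _ _ D) ?leq0n ?leq_subr //=.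
rewrite [leRHS](@big_cat_nat _ _ _ N) //= addrC.
have lev v : (v < S R.+1)%N -> (level_at width R v <= R)%N &&
    (S (level_at width R v) <= v < S (level_at width R v).+1)%N.
  by move=> vS; rewrite level_at_le level_atP.
apply: lerD.
  have -> : \sum_(0 <= v < N) density G (level_at width R v) =
      \sum_(D <= v < S R.+1) density G 0.
    rewrite big_nat (eq_bigr (fun=> density G 0)) => [|v vN].
      by rewrite -big_nat !sumr_const_nat subn0 subKn.
    by rewrite (level_at_uniq (w := width) (j := 0)) // prefixS prefix0.
  apply: ler_sum_nat => v /andP[Dv vS]; have /and3P[lR Sl lS] := lev v vS.
  by apply: density_end => //; rewrite /D in Dv; lia.
rewrite -[N in leRHS]add0n big_addn -/D.
apply: ler_sum_nat => v /andP[_ vD].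
have /and3P[lR Sl lS] := lev v ltac:(lia).
have /and3P[lR' Sl' lS'] := lev (v + N)%N ltac:(lia).
apply: density_linked; last by rewrite /linked; lia.
rewrite lR' andbT lt0n; apply/eqP => l0; move: lS'.
by rewrite l0 /S prefixS prefix0 -/N; lia.
Qed.

Local Open Scope nat_scope.

Section Chains.

Variable succ : T -> T.
Hypothesis succ_inj : injective succ.
Hypothesis succ_next : forall x, next x (succ x).

(** An injective [succ] is a permutation of [T]; its inverse is stopped at rank 0, which cuts the
    cycles into chains. *)
Definition pred_step (y : T) : T := if rk y == 0 then y else invF succ_inj y.

(** [R] steps suffice, since the rank is at most [R] and drops until it is 0. *)
Definition root (y : T) : T := iter R pred_step y.

(** Number of steps down to the root: the iteration is stationary afterwards and contributes
    nothing. *)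
Definition depth (y : T) : nat := \sum_(i < R) (rk (iter i pred_step y) != 0).

Lemma pred_stepP y : rk y != 0 ->
  [/\ succ (pred_step y) = y, linked (rk (pred_step y)) (rk y) & le (pred_step y) y].
Proof.
move=> ry; rewrite /pred_step (negbTE ry); have := succ_next (invF succ_inj y).
by rewrite /next f_invF (negbTE ry) => /andP[].
Qed.

Lemma rk_pred_step y : rk y != 0 -> rk (pred_step y) < rk y.
Proof. by move=> /pred_stepP[_ /linked_lt]. Qed.

Lemma rk_iter i y : rk (iter i pred_step y) <= rk y - i.
Proof.
elim: i => [|i IHi]; first by rewrite subn0.
rewrite iterS; case: (eqVneq (rk (iter i pred_step y)) 0) => r0.
  by rewrite /pred_step r0 eqxx r0.
by have := rk_pred_step r0; lia.
Qed.

Lemma rk_root y : rk (root y) = 0.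
Proof. by have := rk_iter R y; have := rk_le y; rewrite /root; lia. Qed.

Lemma root_rk0 y : rk y = 0 -> root y = y.
Proof.
move=> r0; rewrite /root; elim: R => // i IHi.
by rewrite iterS IHi /pred_step r0.
Qed.

Lemma root_pred y : root (pred_step y) = root y.
Proof. by rewrite /root -iterSr iterS /pred_step -/(root y) rk_root. Qed.

Lemma depth_rk0 y : rk y = 0 -> depth y = 0.
Proof.
move=> r0; apply: big1 => i _; have := rk_iter i y; rewrite r0 => h.
by case: eqP => //; lia.
Qed.

Lemma depth_pred y : rk y != 0 -> depth y = (depth (pred_step y)).+1.
Proof.
(* The added last term is that of the root, hence 0. *)
move=> r0; have -> : depth y = \sum_(i < R.+1) (rk (iter i pred_step y) != 0).
  by rewrite big_ord_recr /= -/(root y) rk_root addn0.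
rewrite big_ord_recl /= r0 add1n; congr _.+1.
by apply: eq_bigr => i _; rewrite add0n -iterS iterSr.
Qed.

Lemma depth_eq0 y : (depth y == 0) = (rk y == 0).
Proof. by case: (eqVneq (rk y) 0) => [/depth_rk0 -> //|/depth_pred ->]. Qed.

Lemma depth_inj x y : root x = root y -> depth x = depth y -> x = y.
Proof.
have [k] := ubnP (depth x); elim: k x y => // k IHk x y kx rxy dxy.
case: (eqVneq (rk x) 0) => rx.
  have ry : rk y = 0 by apply/eqP; rewrite -depth_eq0 -dxy depth_eq0 rx.
  by rewrite -(root_rk0 rx) rxy root_rk0.
have ry : rk y != 0 by rewrite -depth_eq0 -dxy depth_eq0.
have [ex _ _] := pred_stepP rx; have [ey _ _] := pred_stepP ry.
rewrite -ex -ey; congr succ; apply: IHk; rewrite ?root_pred //.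
  by have := depth_pred rx; lia.
by have := depth_pred rx; have := depth_pred ry; lia.
Qed.

Lemma depth_chain x y : root x = root y -> depth x < depth y -> rk x < rk y /\ le x y.
Proof.
have [k] := ubnP (depth y); elim: k y => // k IHk y ky rxy dxy.
have ry : rk y != 0 by rewrite -depth_eq0; lia.
have [_ /linked_lt ltr ley] := pred_stepP ry; have dy := depth_pred ry.
have rp : root x = root (pred_step y) by rewrite root_pred.
case: (ltngtP (depth x) (depth (pred_step y))) => d; try lia.
  have [|h1 h2] := IHk _ _ rp d; first by lia.
  by split; [lia | apply: ple_trans ley].
by rewrite (depth_inj rp d).
Qed.

Lemma root_chain x y : root x = root y -> rk x <= rk y ->
  le x y /\ (rk x = rk y -> x = y).
Proof.
move=> rxy kxy; case: (ltngtP (depth x) (depth y)) => d.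
- by have [h1 h2] := depth_chain rxy d; split=> //; lia.
- by have [] := depth_chain (esym rxy) d; lia.
- by have -> := depth_inj rxy d; split.
Qed.

(** Take the highest element [z] of the class with rank at most [a]. Its successor cannot wrap
    around, is above [a] by maximality, and is not above [b] because layers [a.+1] to [b] fill a
    length [N]. *)
Lemma root_meets_window x a b : b <= R -> S a.+1 + N <= S b.+1 ->
  exists2 y, root y = root x & a < rk y <= b.
Proof.
move=> bR Sab; pose P y := (root y == root x) && (rk y <= a).
have P0 : P (root x) by rewrite /P rk_root (root_rk0 (rk_root x)) eqxx.
case: (arg_maxnP rk P0) => z /andP[/eqP rz za] maxz.
have := succ_next z; rewrite /next.
have Sz := prefix_mono width (za : (rk z).+1 <= a.+1).
case: (eqVneq (rk (succ z)) 0) => r0.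
  by have := prefix_mono width (bR : b.+1 <= R.+1); rewrite -/S in Sz *; lia.
case/andP=> _ lk; have zz := linked_lt lk.
have rs : root (succ z) = root x.
  by rewrite -rz -(root_pred (succ z)) /pred_step (negbTE r0) invF_f.
exists (succ z) => //; apply/andP; split.
  rewrite ltnNge; apply/negP => ra.
  by have := maxz (succ z); rewrite /P rs eqxx ra => /(_ isT); lia.
rewrite leqNgt; apply/negP => br; case/andP: lk => + _.
by have := prefix_mono width br; rewrite -/S in Sz *; lia.
Qed.

(* Two consecutive links advance by more than N on the line of [linked]. *)
Lemma depth_prefix y : (depth y)./2 * N <= S (rk y).
Proof.
have [k] := ubnP (depth y); elim: k y => // k IHk y ky.
case: (eqVneq (rk y) 0) => ry; first by rewrite depth_rk0 //.
have [_ l1 _] := pred_stepP ry; have d1 := depth_pred ry.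
case: (eqVneq (rk (pred_step y)) 0) => rp.
  by rewrite d1 depth_rk0.
have [_ l2 _] := pred_stepP rp; have d2 := depth_pred rp.
rewrite d1 d2 /= mulSn; have := IHk (pred_step (pred_step y)) ltac:(lia).
(* The lower link passes [N] within the interval of [pred_step y]; the upper one leaves that
   interval. *)
have := prefix_mono width (linked_lt l1); case/andP: l2 => _; rewrite -/S; lia.
Qed.

(** [depth] is injective on a class, and [depth_prefix] bounds it because the line has length
    [#|T|]. *)
Lemma card_root_class x : #|[set y | root y == root x]| <= 2 * (#|T| %/ N) + 2.
Proof.
set B := finset _; set D := 2 * (#|T| %/ N) + 1.
have dD y : depth y <= D.
  have h : (depth y)./2 <= #|T| %/ N.
    rewrite leq_divRL ?width_gt0 //; apply: leq_trans (depth_prefix y) _.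
    have -> : #|T| = S R.+1.
      rewrite -cardsT card_by_layer; apply: eq_bigr => i _.
      by rewrite setTI.
    exact/prefix_mono/leqW.
  by have := odd_double_half (depth y); rewrite /D; case: (odd _); lia.
have inj : {in B &, injective (fun y => inord (depth y) : 'I_D.+1)}.
  move=> y z; rewrite !inE => /eqP ry /eqP rz /(congr1 val).
  by rewrite /= !inordK ?ltnS //; apply: depth_inj; rewrite ry.
rewrite -(card_in_imset inj); apply: leq_trans (max_card _) _.
by rewrite card_ord /D addn1 addn2.
Qed.

(** Any [k] consecutive layers of the zone have total size at least [N], so each of the [q] runs
    contains an element of the class. *)
Lemma root_class_zone x a k q : 0 < k -> a + q * k <= R ->
  (forall i, a < i <= a + q * k -> N <= k * width i) ->
  q <= #|[set y | (root y == root x) && (a < rk y <= a + q * k)]|.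
Proof.
move=> k_gt0; elim: q => // q IHq aR wide.
have [||y ry /andP[ay ya]] := @root_meets_window x (a + q * k) (a + q.+1 * k).
- by [].
(* The inequality is multiplied by [k] to avoid dividing [N]. *)
- have ind j : j <= k -> k * S (a + q * k).+1 + j * N <= k * S (a + q * k + j).+1.
    elim: j => [|j IHj] jk; first by rewrite addn0 mul0n addn0.
    have e : S (a + q * k + j).+2 = S (a + q * k + j).+1 + width (a + q * k + j).+1 := prefixS _ _.
    have h : N <= k * width (a + q * k + j).+1 by apply: wide; lia.
    by rewrite addnS e mulnDr mulSn; have := IHj (ltnW jk); lia.
  by rewrite -(leq_pmul2l k_gt0) mulnDr; have := ind k (leqnn k); rewrite mulSnr addnA.
have {}IHq := IHq ltac:(lia) (fun i h => wide i ltac:(lia)).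
apply: leq_trans (_ : q.+1 <= #|y |: [set y | (root y == root x) && (a < rk y <= a + q * k)]|) _.
  by rewrite cardsU1 !inE ry eqxx andTb negb_and -!leqNgt -ltnNge ay orbT add1n ltnS.
apply/subset_leq_card/subsetP => z; rewrite !inE => /orP[/eqP ->|].
  by rewrite ry eqxx; lia.
by case: (_ == _) => //=; lia.
Qed.

(** The zones [(t k, t k.+1]] are disjoint; each is cut into runs of [k.+1] layers, the integer
    division dropping an incomplete run. *)
Lemma root_class_zones x (t : nat -> nat) K : t 1 = 0 -> (forall k, t k <= t k.+1) ->
  t K.+1 <= R ->
  (forall k i, 0 < k <= K -> t k < i <= t k.+1 -> N <= k.+1 * width i) ->
  \sum_(1 <= k < K.+1) (t k.+1 - t k) %/ k.+1 <=
    #|[set y | (root y == root x) && (rk y <= t K.+1)]|.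
Proof.
move=> t1 tmono; elim: K => [|K IHK] tR wide; first by rewrite big_geq.
rewrite big_nat_recr //=.
have {}IHK := IHK (leq_trans (tmono _) tR) (fun k i hk => wide k i ltac:(lia)).
have dt := leq_divM (t K.+2 - t K.+1) K.+2.
have tt := tmono K.+1.
have := @root_class_zone x (t K.+1) K.+2 ((t K.+2 - t K.+1) %/ K.+2) isT.
set q := _ %/ _ in dt * => zone.
have {}zone := zone ltac:(lia) (fun i h => wide K.+1 i ltac:(lia) ltac:(lia)).
apply: leq_trans (leq_add IHK zone) _; rewrite -cardsUI.
set A := [set y | _] in IHK zone *; set B := [set y | _ && (_ < _ <= _)].
have -> : A :&: B = set0.
  by apply/setP => y; rewrite !inE; case: (_ == _) => //=; lia.
rewrite cards0 addn0; apply/subset_leq_card/subsetP => y; rewrite !inE.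
by case: (_ == _) => //=; lia.
Qed.

End Chains.

(** Hall's theorem extracts a permutation from [next]; each chain is the class of elements with a
    given [root] in layer 0. *)
Theorem chain_partition : exists root : T -> T,
  [/\ forall x, rk (root x) = 0,
      forall x, rk x = 0 -> root x = x,
      forall x y, root x = root y -> rk x <= rk y -> le x y /\ (rk x = rk y -> x = y),
      forall x t K, t 1 = 0 -> (forall k, t k <= t k.+1) -> t K.+1 <= R ->
        (forall k i, 0 < k <= K -> t k < i <= t k.+1 -> width 0 <= k.+1 * width i) ->
        \sum_(1 <= k < K.+1) (t k.+1 - t k) %/ k.+1 <=
          #|[set y | root y == root x]|
    & forall x, #|[set y | root y == root x]| <= 2 * (#|T| %/ width 0) + 2].
Proof.
have hall (A : {set T}) : A \subset [set: T] -> #|A| <= #|nbhd next A setT|.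
  by move=> _; exact: next_hall.
have [f [injf fP]] := hall_marriage hall.
have f_inj : injective f by move=> x y; apply: injf.
have f_next x : next x (f x) by have [] := fP x (in_setT x).
exists (root f_inj); split.
- exact: rk_root.
- exact: root_rk0.
- exact: root_chain.
- move=> x t K t1 tmono tR wide.
  apply: leq_trans (root_class_zones f_inj f_next x t1 tmono tR wide) _.
  by apply/subset_leq_card/subsetP => y; rewrite !inE => /andP[].
- exact: card_root_class.
Qed.

End ChainPartition.

(** * Rank-symmetric chains in the Boolean lattice *)

Section RankSymmetric.

Local Open Scope nat_scope.

Lemma bin_anti n k : n <= (2 * k).+1 -> 'C(n, k.+1) <= 'C(n, k).
Proof.
move=> nk; have := mul_bin_left n k.
have nk' : n - k <= k.+1 by lia.
by move=> e; rewrite -(leq_pmul2l (ltn0Sn k)) e leq_mul2r nk' orbT.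
Qed.

Lemma bin_anti_add n k i : n <= 2 * k -> 'C(n, k + i) <= 'C(n, k).
Proof.
move=> nk; elim: i => [|i IHi]; first by rewrite addn0.
by rewrite addnS (leq_trans _ IHi) // bin_anti //; lia.
Qed.

(** Sort by cardinality. The sizes form a strictly increasing list, and reversing their complements
    to [n] gives another with the same members, hence the same list. *)
Lemma rank_symmetric_of_chain n (C : {set {set 'I_n}}) :
  C != set0 ->
  (forall s t, s \in C -> t \in C -> #|s| <= #|t| -> s \subset t) ->
  (forall s, s \in C -> exists2 t, t \in C & #|s| + #|t| = n) ->
  rank_symmetric_chain C.
Proof.
move=> C0 chainC symC; pose r (s t : {set 'I_n}) := #|s| <= #|t|.
have r_total : total r by move=> s t; exact: leq_total.
have r_trans : transitive r by move=> t s u; exact: leq_trans.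
set e := sort r (enum C).
have mem_e s : (s \in e) = (s \in C) by rewrite mem_sort mem_enum.
have uniq_e : uniq e by rewrite sort_uniq enum_uniq.
have sorted_e : sorted r e := sort_sorted r_total _.
have card_inj s t : s \in C -> t \in C -> #|s| = #|t| -> s = t.
  move=> sC tC est; apply/eqP.
  by rewrite eqEsubset !chainC ?est.
pose sz := [seq #|pred_of_set s| | s <- e].
have sz_uniq : uniq sz.
  by rewrite map_inj_in_uniq // => s t; rewrite !mem_e; apply: card_inj.
have sz_sorted : sorted ltn sz.
  by rewrite ltn_sorted_uniq_leq sz_uniq sorted_map.
have sz_le i : i \in sz -> i <= n.
  by case/mapP => s _ ->; rewrite -[n in _ <= n]card_ord max_card.
have sz_rev : rev [seq n - i | i <- sz] = sz.
  apply: (irr_sorted_eq ltn_trans ltnn) => //.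
    rewrite rev_sorted sorted_map.
    apply: (sub_in_sorted (P := fun i => i <= n)) sz_sorted; last exact/allP.
    by move=> i j; rewrite -!topredE /=; lia.
  move=> i; rewrite mem_rev; apply/mapP/idP => [[j /mapP[s se ->] ->]|/mapP[s se ->]].
    have [t tC st] := symC s ltac:(by rewrite -mem_e).
    apply/mapP; exists t; first by rewrite mem_e.
    by move: st; move: #|s| #|t| => a b <-; rewrite addKn.
  have [t tC st] := symC s ltac:(by rewrite -mem_e).
  exists #|t|; last by move: st; move: #|s| #|t| => a b <-; rewrite addnK.
  by apply/mapP; exists t; rewrite ?mem_e.
have [k sk] : exists k, size e = k.+1.
  exists (size e).-1; rewrite prednK // lt0n size_eq0; apply: contraNneq C0 => e0.
  by apply/eqP/setP => s; rewrite -mem_e e0 !inE.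
pose c (i : 'I_k.+1) := nth set0 e i.
have size_e (i : 'I_k.+1) : i < size e by rewrite sk.
have cC i : c i \in C by rewrite -mem_e mem_nth.
have card_c (i : 'I_k.+1) : #|c i| = nth 0 sz i by rewrite (nth_map set0).
exists k, c; split.
- apply/setP => s; rewrite -mem_e; apply/idP/imsetP => [se|[i _ ->]]; last by rewrite mem_e.
  have ks : index s e < k.+1 by rewrite -sk index_mem.
  by exists (Ordinal ks); rewrite // /c /= nth_index.
- move=> i j ij; have lt : #|c i| < #|c j|.
    rewrite !card_c; apply: (sorted_ltn_nth ltn_trans 0 sz_sorted) => //.
    - by rewrite inE size_map.
    - by rewrite inE size_map.
  rewrite properEcard lt andbT; exact/chainC/ltnW.
- move=> i; rewrite !card_c -{2}sz_rev nth_rev ?size_map //.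
  rewrite (nth_map 0) ?size_map sk; last by rewrite /= ; lia.
  have -> : k.+1 - (rev_ord i).+1 = i by rewrite /=; have := ltn_ord i; lia.
  by rewrite subnKC // sz_le // mem_nth // size_map sk.
Qed.

End RankSymmetric.

(** * From the upper half to the whole lattice *)

Section BooleanLattice.

Local Open Scope nat_scope.

Variable n : nat.

(** The least cardinality of a heavy set. *)
Let m := uphalf n.+1.
Let R := n.+1 - m.

Definition upper_set := {x : {set 'I_n.+1} | heavy x}.
Implicit Types x y : upper_set.

Definition upper_rank x : nat := #|val x| - m.

Lemma heavyE (s : {set 'I_n.+1}) : heavy s = (m <= #|s|).
Proof. by rewrite /heavy /m; move: #|s| => k; lia. Qed.

Lemma card_upper x : #|val x| = m + upper_rank x.
Proof. by rewrite /upper_rank subnKC // -heavyE (valP x). Qed.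

Lemma upper_rank_le x : upper_rank x <= R.
Proof.
have := card_upper x; have := max_card (mem (val x)); rewrite card_ord /R.
by move: #|val x| => k; lia.
Qed.

Lemma card_upper_sets (P : pred {set 'I_n.+1}) :
  (forall s, P s -> heavy s) -> #|[set x : upper_set | P (val x)]| = #|[set s | P s]|.
Proof.
move=> Ph; rewrite -(card_imset _ val_inj); apply: eq_card => s.
rewrite [RHS]inE; apply/imsetP/idP => [[x]|Ps]; first by rewrite inE => Px ->.
by exists (Sub s (Ph s Ps)); rewrite ?inE ?SubK.
Qed.

Lemma width_upper i : width upper_rank i = 'C(n.+1, m + i).
Proof.
rewrite -[X in 'C(X, _)](card_ord n.+1) -card_draws.
rewrite -(card_upper_sets (P := fun s => #|s| == m + i)).
  by apply: eq_card => x; rewrite !inE card_upper eqn_add2l.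
by move=> s /eqP cs; rewrite heavyE cs leq_addr.
Qed.

Lemma normalized_matching_upper i j (A : {set upper_set}) : i < j -> j <= R ->
  (forall x, x \in A -> upper_rank x = i) ->
  #|A| * width upper_rank j <=
  #|[set y | (upper_rank y == j) && [exists x in A, nested_le (val x) (val y)]]|
    * width upper_rank i.
Proof.
move=> ij jR rA; rewrite !width_upper -(card_imset A val_inj).
have cA (s : {set 'I_n.+1}) : s \in val @: A -> #|s| = m + i.
  by case/imsetP => x xA ->; rewrite card_upper rA.
have h1 : n.+1 <= 2 * (m + i) by rewrite /m; lia.
have h2 : m + i + (j - i) <= n.+1 by move: jR; rewrite /R /m; lia.
have := nested_matching h1 h2 cA.
have -> : m + i + (j - i) = m + j by lia.
rewrite -(card_upper_sets (P := fun s => (#|s| == m + j) && [exists x in val @: A, nested_le x s])).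
  move=> h; apply: leq_trans h _; rewrite leq_mul2r; apply/orP; right.
  apply/subset_leq_card/subsetP => y; rewrite !inE card_upper eqn_add2l => /andP[-> /=].
  by case/exists_inP => _ /imsetP[x xA ->] xy; apply/exists_inP; exists x.
by move=> s /andP[/eqP cs _]; rewrite heavyE cs leq_addr.
Qed.

Lemma card_matched_upper x : #|matched (val x)| + #|val x| = n.+1.
Proof. exact/card_matched/(valP x). Qed.

Lemma matched_upper_inj x y : matched (val x) = matched (val y) -> x = y.
Proof.
move=> e; apply/val_inj/matched_inj => //; first exact: (valP x).
have := card_matched_upper x; have := card_matched_upper y; rewrite e.
by move: #|matched _| #|val x| #|val y| => a b c; lia.
Qed.

(** The layers of sizes [k] and [n.+1 - k] are equinumerous, so the injection between them is
    onto. *)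
Lemma matched_onto (s : {set 'I_n.+1}) : ~~ heavy s -> exists x, matched (val x) = s.
Proof.
rewrite heavyE -ltnNge => hs; pose k := n.+1 - #|s|.
have sn : #|s| <= n.+1 by have := max_card (mem s); rewrite card_ord.
have [ks mk] : #|s| = n.+1 - k /\ m <= k.
  by move: hs sn; rewrite /k /m; move: #|s| => a; lia.
have kn : k <= n.+1 by rewrite leq_subr.
pose A := [set x : upper_set | #|val x| == k].
pose B := [set t : {set 'I_n.+1} | #|t| == n.+1 - k].
have AB : [set matched (val x) | x in A] \subset B.
  apply/subsetP => _ /imsetP[x + ->]; rewrite !inE => /eqP xk.
  by have := card_matched_upper x; rewrite xk; move: #|matched _| => a; lia.
have cAB : #|[set matched (val x) | x in A]| = #|B|.
  rewrite card_in_imset; last by move=> x y _ _ /matched_upper_inj.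
  rewrite (card_upper_sets (P := fun s => #|s| == k)); last by move=> t /eqP; rewrite heavyE => ->.
  by rewrite !card_draws !card_ord bin_sub.
have /eqP eAB : [set matched (val x) | x in A] == B by rewrite eqEcard AB cAB leqnn.
have : s \in B by rewrite inE ks.
by rewrite -eAB => /imsetP[x _ ->]; exists x.
Qed.

(** The two halves overlap only in an exact middle layer, where nothing is unmatched. *)
Lemma matched_heavy x : heavy (matched (val x)) -> matched (val x) = val x.
Proof.
move=> hx; apply/eqP; rewrite eqEcard matched_sub /=; have := card_matched_upper x.
by move: hx (valP x); rewrite !heavyE /m; move: #|matched _| #|val x| => a b; lia.
Qed.

Lemma matched_heavy_rank0 x : heavy (matched (val x)) -> upper_rank x = 0.
Proof.
move=> hx; have := card_matched_upper x; rewrite (matched_heavy hx) card_upper /m; lia.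
Qed.

Lemma upper_of (s : {set 'I_n.+1}) : exists x, (s == val x) || (s == matched (val x)).
Proof.
case: (boolP (heavy s)) => hs; first by exists (Sub s hs); rewrite SubK eqxx.
by have [x <-] := matched_onto hs; exists x; rewrite eqxx orbT.
Qed.

(** Folds the lattice onto its upper half along $p$. *)
Definition upper (s : {set 'I_n.+1}) : upper_set := xchoose (upper_of s).

Lemma upperP s : s = val (upper s) \/ s = matched (val (upper s)).
Proof. by have /orP[/eqP|/eqP] := xchooseP (upper_of s); [left|right]. Qed.

Lemma upper_val x : upper (val x) = x.
Proof.
case: (upperP (val x)) => [/val_inj //|e]; apply: val_inj; rewrite [RHS]e.
by rewrite matched_heavy // -e (valP x).
Qed.

Lemma upper_matched x : upper (matched (val x)) = x.
Proof.
case: (upperP (matched (val x))) => [e|/matched_upper_inj //].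
by apply: val_inj; rewrite -e matched_heavy // e (valP (upper _)).
Qed.

(** The blocks are the preimages under [upper] of the chains of the upper half, so each is a chain
    [B] together with its image under $p$. *)
Theorem lattice_partition : exists P : {set {set {set 'I_n.+1}}},
  [/\ partition P [set: {set 'I_n.+1}],
      #|P| = 'C(n.+1, n.+1./2)
    & forall C, C \in P ->
      [/\ rank_symmetric_chain C,
          #|C| * 'C(n.+1, n.+1./2) <= 2 * 2 ^ n.+1 + 6 * 'C(n.+1, n.+1./2)
        & forall t K, t 1 = 0 -> (forall k, t k <= t k.+1) -> t K.+1 <= R ->
            (forall k i, 0 < k <= K -> t k < i <= t k.+1 ->
              'C(n.+1, n.+1./2) <= k.+1 * 'C(n.+1, m + i)) ->
            2 * \sum_(1 <= k < K.+1) (t k.+1 - t k) %/ k.+1 <= #|C|.+1]].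
Proof.
have eN : 'C(n.+1, n.+1./2) = 'C(n.+1, m).
  by rewrite /m uphalf_half; have := odd_double_half n.+1; case: odd => [|//] e; rewrite -[LHS]bin_sub; [congr 'C(_, _); lia|lia].
have width0 : width upper_rank 0 = 'C(n.+1, m) by rewrite width_upper addn0.
have width_gt0 i : i <= R -> 0 < width upper_rank i.
  by move=> iR; rewrite width_upper bin_gt0; move: iR; rewrite /R /m; lia.
have width_le0 i : width upper_rank i <= width upper_rank 0.
  by rewrite width0 width_upper bin_anti_add // /m; lia.
have [root [root0 root_id root_chain zones root_card]] :=
  chain_partition upper_rank_le width_gt0 width_le0
    (le := fun x y => nested_le (val x) (val y))
    (fun x => nested_le_refl (val x)) (fun y x z => @nested_le_trans _ (val y) (val x) (val z))
    normalized_matching_upper.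
pose f r := [set s | root (upper s) == r].
pose P := f @: layer upper_rank 0.
have root_in x : root x \in layer upper_rank 0 by rewrite inE root0.
have f_mem r s : (s \in f r) = (root (upper s) == r) by rewrite inE.
have rootP r : r \in layer upper_rank 0 -> root r = r.
  by rewrite inE => /eqP; apply: root_id.
exists P; split.
- apply/and3P; split.
  + rewrite eqEsubset subsetT /=; apply/subsetP => s _; apply/bigcupP.
    by exists (f (root (upper s))); rewrite ?imset_f // f_mem.
  + apply/trivIsetP => _ _ /imsetP[r _ ->] /imsetP[r' _ ->] ne.
    rewrite -setI_eq0; apply: contraNT ne => /set0Pn[s]; rewrite inE !f_mem.
    by case/andP => /eqP <- /eqP ->.
  + apply/imsetP => -[r rL /setP/(_ (val r))]; rewrite in_set0 f_mem upper_val.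
    by rewrite rootP // eqxx.
- rewrite eN -width0 card_in_imset // => r r' rL rL' /setP/(_ (val r)).
  by rewrite !f_mem upper_val rootP // eqxx => /esym/eqP.
move=> C /imsetP[r rL ->]; pose B := [set x | root x == root r].
have memB x : (x \in B) = (root x == r) by rewrite inE (rootP r rL).
have fr : f r = [set val x | x in B] :|: [set matched (val x) | x in B].
  apply/setP => s; rewrite f_mem inE; apply/idP/orP.
    move=> rs; have uB : upper s \in B by rewrite memB.
    by case: (upperP s) => e; [left|right]; apply/imsetP; exists (upper s).
  by case=> /imsetP[x xB ->]; rewrite ?upper_val ?upper_matched; move: xB; rewrite memB.
have cV : #|[set val x | x in B]| = #|B| by rewrite card_imset //; apply: val_inj.
have cM : #|[set matched (val x) | x in B]| = #|B|.
  by rewrite card_in_imset // => x y _ _ /matched_upper_inj.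
(* A common element lies in rank 0, where the chain has only [r]. This accounts for [#|C|.+1] in the
   lower bound. *)
have cI : #|[set val x | x in B] :&: [set matched (val x) | x in B]| <= 1.
  rewrite -(cards1 (val r)); apply/subset_leq_card/subsetP => s.
  move=> /setIP[/imsetP[x xB sx] /imsetP[y yB sy]].
  have hy : heavy (matched (val y)) by rewrite -sy sx (valP x).
  have ry := matched_heavy_rank0 hy; rewrite sy (matched_heavy hy).
  by move: yB; rewrite memB (root_id _ ry) => /eqP ->; rewrite set11.
have c2 := cardsUI [set val x | x in B] [set matched (val x) | x in B].
rewrite cV cM in c2; split.
- apply: rank_symmetric_of_chain.
  + by apply/set0Pn; exists (val r); rewrite f_mem upper_val rootP.
  + have key x y : x \in B -> y \in B -> upper_rank x <= upper_rank y ->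
        val x \subset val y /\ matched (val y) \subset matched (val x).
      rewrite !memB => /eqP rx /eqP ry xy.
      by have [|/andP[h1 h2] _] := root_chain x y _ xy; first by rewrite rx ry.
    have cle (x y : upper_set) : (#|val x| <= #|val y|) = (upper_rank x <= upper_rank y).
      by rewrite !card_upper leq_add2l.
    have cme (x y : upper_set) : (#|matched (val x)| <= #|matched (val y)|) = (upper_rank y <= upper_rank x).
      have := card_matched_upper x; have := card_matched_upper y; rewrite !card_upper.
      by move: #|matched (val x)| #|matched (val y)| => a b; lia.
    move=> s t; rewrite fr !in_setU => /orP[] /imsetP[x xB ->] /orP[] /imsetP[y yB ->].
    * by rewrite cle => /(key _ _ xB yB)[].
    (* A heavy set is no larger than a matched one only in the middle layer, so both equal [r]. *)
    * move=> h; suff e : val x = matched (val y) by rewrite e.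
      have hy : heavy (matched (val y)).
        by rewrite heavyE (leq_trans _ h) // -heavyE (valP x).
      have hx := matched_heavy_rank0 hy.
      have h0 : upper_rank x = 0 by move: h; rewrite (matched_heavy hy) !card_upper hx; lia.
      rewrite (matched_heavy hy); move: xB yB.
      by rewrite !memB (root_id _ h0) (root_id _ hx) => /eqP -> /eqP ->.
    * move=> _; case: (leqP (upper_rank x) (upper_rank y)) => [|/ltnW] xy.
        by have [h _] := key _ _ xB yB xy; apply: subset_trans (matched_sub _) h.
      by have [_ h] := key _ _ yB xB xy; apply: subset_trans h (matched_sub _).
    * by rewrite cme => /(key _ _ yB xB)[].
  + move=> s; rewrite fr !in_setU => /orP[] /imsetP[x xB ->].
      exists (matched (val x)); last by rewrite addnC; apply: card_matched_upper.
      by apply/setUP; right; apply/imsetP; exists x.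
    exists (val x); last exact: card_matched_upper.
    by apply/setUP; left; apply/imsetP; exists x.
- have cB : #|B| <= 2 * (#|{: upper_set}| %/ 'C(n.+1, m)) + 2.
    by have := root_card r; rewrite width0.
  have N_gt0 : 0 < 'C(n.+1, m) by rewrite -width0 width_gt0.
  (* The upper half and its image together have at most [2 ^ n.+1] sets and overlap within the
     middle layer. *)
  have T2 : 2 * #|{: upper_set}| <= 2 ^ n.+1 + 'C(n.+1, m).
    pose V := [set val x | x : upper_set]; pose M := [set matched (val x) | x : upper_set].
    have <- : #|V| = #|{: upper_set}| by rewrite card_imset //; apply: val_inj.
    have cMV : #|M| = #|V|.
      rewrite card_in_imset; last by move=> x y _ _ /matched_upper_inj.
      by rewrite card_imset //; apply: val_inj.
    have -> : 2 * #|V| = #|V :|: M| + #|V :&: M| by rewrite cardsUI cMV mul2n addnn.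
    apply: leq_add.
      apply: leq_trans (max_card _) _.
      by rewrite -cardsT -powersetT card_powerset cardsT card_ord.
    rewrite -width0 /width -(card_imset (layer upper_rank 0) val_inj).
    apply/subset_leq_card/subsetP => s /setIP[/imsetP[x _ sx] /imsetP[y _ sy]].
    have hy : heavy (matched (val y)) by rewrite -sy sx (valP x).
    by rewrite sy (matched_heavy hy) imset_f // inE (matched_heavy_rank0 hy).
  have : #|f r| <= 2 * (2 * (#|{: upper_set}| %/ 'C(n.+1, m)) + 2).
    move: c2 cB; rewrite fr; move: #|_ :|: _| #|_ :&: _| #|B| (_ %/ _) => a b c d; lia.
  rewrite eN.
  (* With U the size of the upper half and N the middle binomial, |C| N <= 4U + 4N and 2U <= 2^(n+1)
     + N; hence the constants 2 and 6. *)
  have := leq_divM #|{: upper_set}| 'C(n.+1, m).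
  move: #|f r| #|{: upper_set}| 'C(n.+1, m) T2 => a u N T2; move: (u %/ N) => q.
  by nia.
- move=> t K t1 tmono tR wide.
  have wide' k i : 0 < k <= K -> t k < i <= t k.+1 ->
      width upper_rank 0 <= k.+1 * width upper_rank i.
    by move=> hk hi; rewrite width0 width_upper -eN; apply: wide.
  have := zones r t K t1 tmono tR wide'; rewrite -/B fr => h.
  by rewrite -[X in _ <= X.+1](addnK #|[set val x | x in B] :&: [set matched (val x) | x in B]|) c2; lia.
Qed.

End BooleanLattice.

(** * Asymptotics *)

From mathcomp Require Import ring lra.
From mathcomp Require Import all_classical all_reals all_analysis.
Import Order.TTheory GRing.Theory Num.Theory.
Import numFieldNormedType.Exports.

Lemma central_bin_even (m : nat) : (16 ^ m.+1 <= 4 * m.+1 * 'C(2 * m.+1, m.+1) ^ 2)%N.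
Proof.
elim: m => [//|m IHm].
have e : (m.+2 * 'C(2 * m.+2, m.+2) = 2 * (2 * m.+1).+1 * 'C(2 * m.+1, m.+1))%N.
  have -> : (2 * m.+2 = (2 * m.+1).+2)%N by lia.
  have h1 := mul_bin_diag (2 * m.+1).+2 m.+1; have h2 := mul_bin_left (2 * m.+1) m.
  have h3 := mul_bin_diag (2 * m.+1).+1 m; have h4 := binS (2 * m.+1) m.
  rewrite /= in h1 h3; nia.
set a := 'C(_, m.+1) in IHm e *; set b := 'C(_, m.+2) in e *.
rewrite -(leq_pmul2l (ltn0Sn m.+1)) expnS.
have -> : (m.+2 * (4 * m.+2 * b ^ 2) = 4 * (m.+2 * b) ^ 2)%N by rewrite expnMn; lia.
rewrite e; apply: leq_trans (_ : m.+2 * (16 * (4 * m.+1 * a ^ 2)) <= _)%N.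
  by rewrite !leq_mul2l IHm !orbT.
(* This amounts to 4(m+1)(m+2) <= (2m+3)^2. *)
by rewrite !expnMn; move: (a ^ 2)%N => A; nia.
Qed.

(** The odd case follows from the even one, as C(2m+2, m+1) is twice C(2m+1, m). *)
Lemma central_bin (n : nat) : (0 < n)%N -> (4 ^ n <= 4 * n * 'C(n, n./2) ^ 2)%N.
Proof.
move=> n_gt0; have := odd_double_half n; case: (odd n) => /= en.
  set m := n./2 in en *; have -> : n = (2 * m).+1 by lia.
  have e : 'C(2 * m.+1, m.+1) = (2 * 'C((2 * m).+1, m))%N.
    have -> : (2 * m.+1 = (2 * m).+2)%N by lia.
    have h1 := mul_bin_diag (2 * m).+2 m; rewrite /= in h1; nia.
  have := central_bin_even m; rewrite e expnMn => h.
  rewrite -(leq_pmul2l (isT : 0 < 4)%N) -expnS.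
  have -> : (4 ^ (2 * m).+2 = 16 ^ m.+1)%N.
    by rewrite (_ : 16 = 4 ^ 2)%N // -expnM; congr (_ ^ _)%N; lia.
  apply: leq_trans h _; rewrite (_ : 2 ^ 2 = 4)%N // !mulnA leq_mul2r.
  by apply/orP; right; lia.
case: n./2 en n_gt0 => [|m] en n_gt0; first by lia.
have -> : n = (2 * m.+1)%N by lia.
rewrite expnM (_ : 4 ^ 2 = 16)%N //; apply: leq_trans (central_bin_even m) _.
by rewrite leq_mul2r; apply/orP; right; lia.
Qed.

Section Estimates.

Variable R : realType.

Lemma pow2_le_central_bin (n : nat) : (0 < n)%N ->
  (2 ^ n)%N%:R <= 2 * Num.sqrt n%:R * ('C(n, n./2))%:R :> R.
Proof.
move=> n_gt0; rewrite -(ler_pXn2r (ltn0Sn 1)) ?nnegrE ?mulr_ge0 ?ler0n ?sqrtr_ge0 //.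
rewrite !exprMn sqr_sqrtr ?ler0n // -!natrX -!natrM ler_nat -expnM mulnC expnM.
exact: central_bin.
Qed.

(* Each factor of C(n, m) / C(n, m + i) is at most (m + j) / (m - j) for some
   j <= i, hence at most exp(2 j / (m - i)). *)
Lemma central_bin_ratio (n i : nat) : (i < uphalf n)%N ->
  ('C(n, uphalf n))%:R <=
    ('C(n, uphalf n + i))%:R * expR ((i * i.+1)%:R / (uphalf n - i)%:R) :> R.
Proof.
set m := uphalf n => im.
(* The denominator stays fixed so that the exponents 2, 4, ..., 2j add up to j(j+1). *)
suff H j : (j <= i)%N -> ('C(n, m))%:R <=
    ('C(n, m + j))%:R * expR ((j * j.+1)%:R / (m - i)%:R) :> R by apply: H.
have mi_gt0 : 0 < (m - i)%:R :> R by rewrite ltr0n subn_gt0.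
elim: j => [|j IHj] ji; first by rewrite addn0 mul0n mul0r expR0 mulr1.
apply: le_trans (IHj (ltnW ji)) _.
have -> : ((j.+1 * j.+2)%:R / (m - i)%:R = (j * j.+1)%:R / (m - i)%:R + (2 * j.+1)%:R / (m - i)%:R :> R).
  by rewrite -mulrDl -natrD; congr (_%:R / _); lia.
rewrite expRD mulrCA [leLHS]mulrC ler_pM2l ?expR_gt0 //.
have mj_gt0 : 0 < (m - j.+1)%:R :> R by rewrite ltr0n subn_gt0; lia.
have eb : (m + j).+1%:R * ('C(n, m + j.+1))%:R = (n - (m + j))%:R * ('C(n, m + j))%:R :> R.
  by rewrite -!natrM addnS mul_bin_left.
have le1 : (m - j.+1)%:R <= (n - (m + j))%:R :> R by rewrite ler_nat /m; lia.
rewrite -(ler_pM2l (lt_le_trans mj_gt0 le1)) -eb mulrCA [leLHS]mulrC.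
rewrite ler_wpM2l ?ler0n //.
apply: le_trans (_ : (m - j.+1)%:R * expR ((2 * j.+1)%:R / (m - i)%:R) <= _); last first.
  by rewrite ler_wpM2r ?expR_ge0.
apply: le_trans (_ : (m - j.+1)%:R * (1 + (2 * j.+1)%:R / (m - j.+1)%:R) <= _).
  by rewrite mulrDr mulr1 mulrC divfK ?gt_eqF // -natrD ler_nat; lia.
rewrite ler_wpM2l ?ler0n //; apply: le_trans (expR_ge1Dx _) _.
rewrite ler_expR ler_wpM2l ?ler0n // lef_pV2 ?posrE // ler_nat; lia.
Qed.

Lemma central_bin_ln (n i k : nat) : (0 < k)%N -> (i < uphalf n)%N ->
  (i * i.+1)%:R <= (uphalf n - i)%:R * ln k%:R :> R ->
  ('C(n, uphalf n) <= k * 'C(n, uphalf n + i))%N.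
Proof.
move=> k_gt0 im h; rewrite -(ler_nat R); apply: le_trans (central_bin_ratio im) _.
rewrite [leRHS]natrM [leRHS]mulrC ler_wpM2l ?ler0n //.
rewrite -[leRHS]lnK ?posrE ?ltr0n // ler_expR ler_pdivrMr ?ltr0n ?subn_gt0 //.
by rewrite mulrC.
Qed.

Definition sqrt_ln (k : nat) : R := Num.sqrt (ln k%:R).

Lemma ln_nat_ge0 (k : nat) : 0 <= ln k%:R :> R.
Proof. by case: k => [|k]; [rewrite ln0 | rewrite ln_ge0 // ler1n]. Qed.

Lemma ln_nat_mono (j k : nat) : (0 < j <= k)%N -> ln j%:R <= ln k%:R :> R.
Proof. by move=> /andP[j0 jk]; rewrite ler_ln ?posrE ?ltr0n ?ler_nat //; lia. Qed.

Lemma sqrt_ln_mono (k : nat) : sqrt_ln k <= sqrt_ln k.+1.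
Proof.
rewrite /sqrt_ln ler_sqrt ?ln_nat_ge0 //.
by case: k => [|k]; [rewrite ln0 // ln_nat_ge0 | apply: ln_nat_mono; lia].
Qed.

Lemma sqrt_ln1 : sqrt_ln 1 = 0.
Proof. by rewrite /sqrt_ln ln1 sqrtr0. Qed.

Definition alpha_sum (K : nat) : R :=
  \sum_(1 <= k < K.+1) (sqrt_ln k.+1 - sqrt_ln k) / k.+1%:R.

(* The layers up to this index have size at least N / k, where N is the size of
   the middle layer; the shift by K+1 absorbs the lower order terms. *)
Definition threshold (n K k : nat) : nat :=
  Num.truncn (Num.sqrt (n%:R / 2) * sqrt_ln k - K.+1%:R).

Lemma threshold_le (n K k : nat) :
  (threshold n K k)%:R <= Num.sqrt (n%:R / 2) * sqrt_ln k.
Proof.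
rewrite /threshold; set a := _ * _; have a0 : 0 <= a by rewrite mulr_ge0 ?sqrtr_ge0.
have [h|h] := leP 0 (a - K.+1%:R).
  by have := h; rewrite -truncn_le => /le_trans; apply; rewrite gerBl ler0n.
have /eqP -> : Num.truncn (a - K.+1%:R) == 0%N; last by [].
by rewrite -leqn0 truncn_le_nat; apply: lt_trans h _.
Qed.

Lemma threshold_ge (n K k : nat) :
  Num.sqrt (n%:R / 2) * sqrt_ln k - K.+2%:R <= (threshold n K k)%:R.
Proof.
have := truncnS_gt (Num.sqrt (n%:R / 2) * sqrt_ln k - K.+1%:R); rewrite -/(threshold _ _ _).
rewrite -!natr1; lra.
Qed.

Lemma threshold_mono (n K k : nat) : (threshold n K k <= threshold n K k.+1)%N.
Proof. by apply: le_truncn; rewrite lerD2r ler_wpM2l ?sqrtr_ge0 ?sqrt_ln_mono. Qed.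

Lemma threshold1 (n K : nat) : threshold n K 1 = 0%N.
Proof.
apply/eqP; rewrite -leqn0 truncn_le_nat sqrt_ln1 mulr0 sub0r.
by apply: lt_le_trans (_ : 0 <= _); rewrite ?oppr_lt0 ?ltr0n.
Qed.

(** Since ln k <= K, the shift gives i(i+1) + i ln k <= (i+K+1)^2 <= (n/2) ln k. *)
Lemma threshold_ln (n K k i : nat) : (0 < k <= K.+1)%N -> (0 < i <= threshold n K k)%N ->
  (i < uphalf n)%N /\ (i * i.+1)%:R <= (uphalf n - i)%:R * ln k%:R :> R.
Proof.
move=> /andP[k0 kK] /andP[i0 it]; set L := ln k%:R.
have L0 : 0 <= L := ln_nat_ge0 k.
have i1 : 1 <= i%:R :> R by rewrite ler1n.
have LK : L <= K%:R.
  have := le_ln1Dx (x := k%:R - 1 : R); rewrite addrCA subrr addr0 -/L => h.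
  have k1 : 1 <= k%:R :> R by rewrite ler1n.
  have kK' : k%:R <= K%:R + 1 :> R by rewrite natr1 ler_nat.
  by apply: le_trans (h _) _; lra.
have : i%:R <= Num.sqrt (n%:R / 2) * sqrt_ln k - K.+1%:R.
  rewrite -truncn_ge_nat //; apply: le_trans ler01 _.
  by rewrite -truncn_gt0; exact: leq_trans it.
rewrite -[K.+1%:R]natr1 -sqrtrM ?divr_ge0 // -/L => h.
have h' : (i%:R + (K%:R + 1)) ^+ 2 <= n%:R / 2 * L.
  rewrite -[leRHS]sqr_sqrtr ?mulr_ge0 ?divr_ge0 // ler_pXn2r // ?nnegrE ?sqrtr_ge0 //; last by lra.
have nm : n%:R / 2 <= (uphalf n)%:R :> R.
  by rewrite ler_pdivrMr // -natrM ler_nat; lia.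
have main : i%:R * (i%:R + 1) + i%:R * L <= (uphalf n)%:R * L.
  by apply: le_trans (ler_wpM2r L0 nm); apply: le_trans h'; nra.
have im : (i < uphalf n)%N.
  rewrite ltnNge; apply/negP => mi; have mi' : (uphalf n)%:R <= i%:R :> R by rewrite ler_nat.
  by have := ler_wpM2r L0 mi'; nra.
split=> //; rewrite natrB; last exact: ltnW.
by rewrite natrM -natr1; lra.
Qed.

Lemma divn_natr_ge (a b : nat) : (0 < b)%N -> a%:R / b%:R - 1 <= (a %/ b)%:R :> R.
Proof.
move=> b0; rewrite lerBlDr ler_pdivrMr ?ltr0n // natr1 -natrM ler_nat.
by rewrite ltnW // ltn_ceil.
Qed.

(** Each of the [K] terms loses at most [K.+2] to the shift and truncation of the thresholds, and 1
    to the integer division. *)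
Lemma threshold_sum (n K : nat) :
  Num.sqrt (n%:R / 2) * alpha_sum K - (K * (K + 3))%:R <=
  (\sum_(1 <= k < K.+1) (threshold n K k.+1 - threshold n K k) %/ k.+1)%N%:R.
Proof.
rewrite /alpha_sum mulr_sumr natr_sum.
have -> : (K * (K + 3))%:R = \sum_(1 <= k < K.+1) (K + 3)%:R :> R.
  by rewrite natrM mulr_natl sumr_const_nat subn1.
rewrite -sumrB; apply: ler_sum_nat => k /andP[k1 kK].
apply: le_trans (divn_natr_ge _ (ltn0Sn k)).
rewrite natrB ?threshold_mono //; have := threshold_le n K k; have := threshold_ge n K k.+1.
set s := Num.sqrt _; set a := sqrt_ln k.+1; set b := sqrt_ln k => h1 h2.
have k0 : 0 < k.+1%:R :> R by rewrite ltr0n.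
have h3 : (K.+2%:R / k.+1%:R <= K.+2%:R :> R).
  by rewrite ler_pdivrMr // ler_peMr ?ler0n // ler1n.
have h4 : (s * a - K.+2%:R - s * b) / k.+1%:R <=
    ((threshold n K k.+1)%:R - (threshold n K k)%:R) / k.+1%:R.
  by apply: ler_wpM2r; [rewrite invr_ge0 ler0n | lra].
have -> : (K + 3)%:R = K.+2%:R + 1 :> R by rewrite natr1 addn3.
have -> : s * ((a - b) / k.+1%:R) = (s * a - K.+2%:R - s * b) / k.+1%:R + K.+2%:R / k.+1%:R by ring.
move: h3 h4; set p := (s * a - _ - _) / _; set q := (_%:R - _) / _; set r := K.+2%:R / _.
by move: p q r K.+2%:R => p q r c; lra.
Qed.

(** For fixed [K] the error in the lower bound does not depend on [n]. *)
Lemma partition_estimates (K n : nat) : (0 < n)%N ->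
  exists P : {set {set {set 'I_n}}},
    [/\ finset.partition P [set: {set 'I_n}]%SET,
        #|P| = 'C(n, n./2)
      & forall C : {set {set 'I_n}}, C \in P ->
          rank_symmetric_chain C /\
          Num.sqrt 2 * alpha_sum K * Num.sqrt n%:R - (2 * (K * (K + 3)) + 1)%:R
            <= (#|C|%:R : R) <= 10 * Num.sqrt n%:R].
Proof.
case: n => // n _; have [P [partP cardP chainP]] := lattice_partition n.
exists P; split=> // C CP; have [symC upC loC] := chainP C CP; split=> //.
have N_gt0 : (0 < 'C(n.+1, n.+1./2))%N by rewrite bin_gt0; lia.
have eN : 'C(n.+1, n.+1./2) = 'C(n.+1, uphalf n.+1).
  rewrite -[RHS]bin_sub; last by lia.
  by congr 'C(_, _); lia.
apply/andP; split.
  have tln k i := @threshold_ln n.+1 K k i.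
  have tR : (threshold n.+1 K K.+1 <= n.+1 - uphalf n.+1)%N.
    case: (posnP (threshold n.+1 K K.+1)) => [->//|t0].
    by have [] := tln K.+1 _ (leqnn K.+1) (introT andP (conj t0 (leqnn _))); lia.
  have wide k i : (0 < k <= K)%N ->
      (threshold n.+1 K k < i <= threshold n.+1 K k.+1)%N ->
      ('C(n.+1, n.+1./2) <= k.+1 * 'C(n.+1, uphalf n.+1 + i))%N.
    move=> /andP[k0 kK] /andP[ki ik]; rewrite eN.
    have [|| im h] := tln k.+1 i; [by lia | by lia |].
    exact: central_bin_ln im h.
  have h := loC _ K (threshold1 _ _) (threshold_mono _ _) tR wide.
  move: h; rewrite -(ler_nat R) natrM -[#|C|.+1%:R]natr1 => h.
  have := threshold_sum n.+1 K => h2.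
  have -> : Num.sqrt 2 * alpha_sum K * Num.sqrt n.+1%:R =
      2 * (Num.sqrt (n.+1%:R / 2) * alpha_sum K) :> R.
    have -> : Num.sqrt n.+1%:R = Num.sqrt 2 * Num.sqrt (n.+1%:R / 2) :> R.
      by rewrite -sqrtrM // mulrCA divff ?mulr1.
    have := sqr_sqrtr (ler0n R 2); rewrite expr2 => s2; ring: s2.
  by rewrite natrD natrM; lra.
have N_gt0' : 0 < ('C(n.+1, n.+1./2))%:R :> R by rewrite ltr0n.
rewrite -(ler_pM2r N_gt0').
move: upC; rewrite -(ler_nat R) natrD !natrM => /le_trans; apply.
(* 10 = 4 + 6: the power of 2 contributes 4 sqrt n, and the constant 6 is at most 6 sqrt n. *)
have := pow2_le_central_bin (ltn0Sn n).
have s1 : 1 <= Num.sqrt n.+1%:R :> R by rewrite -[leLHS]sqrtr1 ler_sqrt // ler1n.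
by set c : R := ('C(_, _))%:R in N_gt0' *; set s := Num.sqrt _ in s1 *; nra.
Qed.

End Estimates.

(** * Numerical bounds and convergence for alpha *)

Section Alpha.

Variable R : realType.

(** 17/800 is 17/25 divided by 2^5: start from exp(-x) >= 1 - x there and square five times,
    rounding down. *)
Lemma ln2_ge : 17 / 25 <= ln 2 :> R.
Proof.
have sq (x r : R) : 0 <= r -> r <= expR x -> r ^+ 2 <= expR (2 * x).
  by move=> r0 rx; rewrite expRM_natl ler_pXn2r // nnegrE expR_ge0.
have h0 : 783 / 800 <= expR (- (17 / 800)) :> R.
  by apply: le_trans (expR_ge1Dx _); lra.
have h1 : 205 / 214 <= expR (2 * (- (17 / 800))) :> R.
  by apply: le_trans (sq _ _ _ h0); lra.
have h2 : 323 / 352 <= expR (2 * (2 * (- (17 / 800)))) :> R.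
  by apply: le_trans (sq _ _ _ h1); lra.
have h3 : 842 / 1000 <= expR (2 * (2 * (2 * (- (17 / 800))))) :> R.
  by apply: le_trans (sq _ _ _ h2); lra.
have h4 : 358 / 505 <= expR (2 * (2 * (2 * (2 * (- (17 / 800)))))) :> R.
  by apply: le_trans (sq _ _ _ h3); lra.
have h5 : 2^-1 <= expR (2 * (2 * (2 * (2 * (2 * (- (17 / 800))))))) :> R.
  by apply: le_trans (sq _ _ _ h4); lra.
have e : 2 * (2 * (2 * (2 * (2 * (- (17 / 800)))))) = - (17 / 25) :> R by lra.
rewrite e expRN lef_pV2 ?posrE ?expR_gt0 // in h5.
by rewrite -ler_expR lnK ?posrE.
Qed.

(** From 2^a <= k^b follows b ln k >= a ln 2, which reduces the bound to integer arithmetic. *)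
Lemma sqrt_ln_ge (k a b : nat) (q : R) : (0 < k)%N -> (2 ^ a <= k ^ b)%N -> (0 < b)%N ->
  0 <= q -> b%:R * q ^+ 2 <= a%:R * (17 / 25) -> q <= sqrt_ln R k.
Proof.
move=> k0 hab b0 q0 hq; rewrite /sqrt_ln -[q]ger0_norm // -sqrtr_sqr ler_sqrt ?ln_nat_ge0 //.
rewrite -(ler_pM2l (x := b%:R)) ?ltr0n //; apply: le_trans hq _.
apply: le_trans (ler_wpM2l (ler0n _ a) ln2_ge) _.
rewrite !mulr_natl -!lnXn ?ltr0n // ler_ln ?posrE ?exprn_gt0 ?ltr0n // -!natrX.
by rewrite ler_nat.
Qed.

(** Summation by parts gives each [sqrt_ln] a positive coefficient, so lower bounds suffice; indices
    without their own bound inherit one by monotonicity. Finally 41/29 times 17/30 exceeds 0.8. *)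
Lemma alpha_sum15_gt : 8 / 10 < Num.sqrt 2 * alpha_sum R 15.
Proof.
have s2 : 41 / 29 <= Num.sqrt 2 :> R.
  rewrite -[leLHS]ger0_norm; last by lra.
  by rewrite -sqrtr_sqr ler_sqrt //; lra.
have k2 : 14 / 17 <= sqrt_ln R 2 by apply: (@sqrt_ln_ge 2 1 1 _ isT isT isT); lra.
have k3 : 112 / 111 <= sqrt_ln R 3 by apply: (@sqrt_ln_ge 3 3 2 _ isT isT isT); lra.
have k4 : 162 / 139 <= sqrt_ln R 4 by apply: (@sqrt_ln_ge 4 2 1 _ isT isT isT); lra.
have k6 : 43 / 33 <= sqrt_ln R 6 by apply: (@sqrt_ln_ge 6 5 2 _ isT isT isT); lra.
have k8 : 97 / 68 <= sqrt_ln R 8 by apply: (@sqrt_ln_ge 8 3 1 _ isT isT isT); lra.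
have k12 : 37 / 24 <= sqrt_ln R 12 by apply: (@sqrt_ln_ge 12 7 2 _ isT isT isT); lra.
have k16 : 61 / 37 <= sqrt_ln R 16 by apply: (@sqrt_ln_ge 16 4 1 _ isT isT isT); lra.
have m k := sqrt_ln_mono R k.
suff h : 17 / 30 <= alpha_sum R 15.
  by apply: lt_le_trans (ler_pM _ _ s2 h); lra.
rewrite /alpha_sum unlock /= sqrt_ln1.
move: (m 4) (m 6) (m 8) (m 9) (m 10) (m 12) (m 13) (m 14); move: k2 k3 k4 k6 k8 k12 k16.
move: (sqrt_ln R 2) (sqrt_ln R 3) (sqrt_ln R 4) (sqrt_ln R 5) (sqrt_ln R 6).
move: (sqrt_ln R 7) (sqrt_ln R 8) (sqrt_ln R 9) (sqrt_ln R 10) (sqrt_ln R 11).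
move: (sqrt_ln R 12) (sqrt_ln R 13) (sqrt_ln R 14) (sqrt_ln R 15) (sqrt_ln R 16).
by move=> *; lra.
Qed.

Lemma alpha_sumE (K : nat) : alpha_sum R K =
  \sum_(2 <= k < K.+2) (Num.sqrt (ln k%:R) - Num.sqrt (ln (k%:R - 1))) / k%:R.
Proof.
rewrite big_add1 /=; apply: eq_bigr => k _.
by have -> : k.+1%:R - 1 = k%:R :> R by rewrite -natr1 addrK.
Qed.

(* (s' - s) s' <= s'^2 - s^2 for s <= s', and sqrt(ln k) >= 1/2 for k >= 2. *)
Lemma alpha_term_le (k : nat) : (0 < k)%N ->
  (sqrt_ln R k.+1 - sqrt_ln R k) / k.+1%:R <= 2 * (k%:R^-1 - k.+1%:R^-1).
Proof.
move=> k0; have k0' : 0 < k%:R :> R by rewrite ltr0n.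
have k1' : 0 < k.+1%:R :> R by rewrite ltr0n.
have -> : 2 * (k%:R^-1 - k.+1%:R^-1) = 2 / k%:R / k.+1%:R :> R.
  by rewrite -[k.+1%:R]natr1; field; rewrite natr1 !gt_eqF.
rewrite ler_pM2r ?invr_gt0 //.
have half : 2^-1 <= sqrt_ln R k.+1.
  by apply: (@sqrt_ln_ge k.+1 1 1) => //; lra.
have mono := sqrt_ln_mono R k; have s0 : 0 <= sqrt_ln R k := sqrtr_ge0 _.
have lnle : sqrt_ln R k.+1 ^+ 2 - sqrt_ln R k ^+ 2 <= k%:R^-1.
  rewrite !sqr_sqrtr ?ln_nat_ge0 // -ln_div ?posrE //.
  have -> : k.+1%:R / k%:R = 1 + k%:R^-1 :> R.
    by rewrite -natr1 mulrDl divff ?gt_eqF // mul1r.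
  by apply: le_ln1Dx; apply: lt_le_trans (_ : 0 <= _); rewrite ?invr_ge0 ?oppr_lt0 ?ltW.
by move: (k%:R^-1) lnle => x; nra.
Qed.

(** The partial sums increase, and [alpha_term_le] telescopes to the bound 2. *)
Lemma alpha_cvg : cvgn (fun m : nat => \sum_(2 <= k < m)
  (Num.sqrt (ln k%:R) - Num.sqrt (ln (k%:R - 1))) / k%:R : R).
Proof.
set u := (fun m => _).
have uS K : u K.+2 = alpha_sum R K by rewrite alpha_sumE.
have t0 k : 0 <= (sqrt_ln R k.+1 - sqrt_ln R k) / k.+1%:R.
  by rewrite divr_ge0 ?ler0n // subr_ge0 sqrt_ln_mono.
have u0 m : (m <= 2)%N -> u m = 0 by move=> m2; rewrite /u big_geq.
apply: nondecreasing_is_cvgn.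
  apply/nondecreasing_seqP => -[|[|K]]; rewrite ?[u 0]u0 ?[u 1]u0 ?[u 2]u0 //.
  by rewrite !uS /alpha_sum [leRHS]big_nat_recr //= lerDl t0.
exists 2 => _ [[|[|K]] _ <-]; rewrite ?[u 0]u0 ?[u 1]u0 // uS.
have : alpha_sum R K <= 2 * (1 - K.+1%:R^-1).
  elim: K => [|K IHK]; first by rewrite /alpha_sum big_geq // invr1 subrr mulr0.
  rewrite /alpha_sum big_nat_recr //=; have := alpha_term_le (ltn0Sn K).
  move: IHK; rewrite /alpha_sum; move: (\sum_(_ <= _ < _) _) ((_ - _) / _).
  by move: K.+1%:R^-1 K.+2%:R^-1 => a b c d; lra.
have : 0 <= K.+1%:R^-1 :> R by rewrite invr_ge0 ler0n.
by move: K.+1%:R^-1 (alpha_sum R K) => a b; lra.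
Qed.

Lemma alpha_approx (eps : R) : 0 < eps ->
  exists K : nat, alpha R - eps < Num.sqrt 2 * alpha_sum R K.
Proof.
move=> eps0; have s2 : 0 < Num.sqrt 2 :> R by rewrite sqrtr_gt0.
have : \forall m \near \oo%classic, limn (fun m : nat => \sum_(2 <= k < m)
   (Num.sqrt (ln k%:R) - Num.sqrt (ln (k%:R - 1))) / k%:R : R) - eps / Num.sqrt 2 <
   \sum_(2 <= k < m) (Num.sqrt (ln k%:R) - Num.sqrt (ln (k%:R - 1))) / k%:R.
  by apply: (cvgr_gt _ alpha_cvg); rewrite gtrBl divr_gt0.
case=> m _ /(_ m.+2); rewrite /= -alpha_sumE => h; exists m.
have {}h := h (leqW (leqW (leqnn m))).
rewrite -(ltr_pM2l s2) mulrBr in h.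
by rewrite /alpha; move: h; rewrite [_ * (eps / _)]mulrCA divff ?gt_eqF // mulr1.
Qed.

Lemma sqrt_eventually_ge (c eta : R) : 0 < eta ->
  exists N : nat, forall n : nat, (N < n)%N -> c <= eta * Num.sqrt n%:R.
Proof.
move=> eta0; exists (Num.truncn ((c / eta) ^+ 2)) => n; rewrite truncn_lt_nat ?sqr_ge0 // => h.
rewrite mulrC -ler_pdivrMr //; apply: le_trans (ler_norm _) _.
by rewrite -sqrtr_sqr ler_sqrt // ltW.
Qed.

Lemma rank_symmetric_partition (K : nat) (a : R) : a < Num.sqrt 2 * alpha_sum R K ->
  exists N : nat, forall n : nat, (N < n)%N ->
  exists P : {set {set {set 'I_n}}},
    [/\ finset.partition P [set: {set 'I_n}]%SET,
        #|P| = 'C(n, n./2)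
      & forall C : {set {set 'I_n}}, C \in P ->
          rank_symmetric_chain C /\
          a * Num.sqrt n%:R <= (#|C|%:R : R) <= 10 * Num.sqrt n%:R].
Proof.
rewrite -subr_gt0 => eta0.
(* The gap between [a] and the partial sum, times sqrt n, eventually absorbs the constant error. *)
have [N HN] := sqrt_eventually_ge (2 * (K * (K + 3)) + 1)%:R eta0.
exists N => n Nn; have n0 : (0 < n)%N by lia.
have [P [partP cardP chainP]] := partition_estimates R K n0.
exists P; split=> // C CP; have [symC /andP[lo up]] := chainP C CP.
split=> //; rewrite up andbT; apply: le_trans lo.
by have := HN n Nn; rewrite mulrBl; lra.
Qed.

End Alpha.

(* The range of eps is (0, alpha), where the lower bound is positive.  An upper
   bound on eps is necessary: since 'C(n, n./2) * sqrt n < 2 ^ n, no partition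
   into 'C(n, n./2) sets has all sizes at most c * sqrt n / eps if eps >= c. *)
Theorem theorem1p4 (R : realType) :
  (exists c : R, 0 < c /\
    forall eps : R, 0 < eps -> eps < alpha R ->
    exists N : nat, forall n : nat, (N < n)%N ->
    exists P : {set {set {set 'I_n}}},
      [/\ finset.partition P [set: {set 'I_n}]%SET,
          #|P| = 'C(n, n./2)
        & forall C : {set {set 'I_n}}, C \in P ->
            rank_symmetric_chain C /\
            (alpha R - eps) * Num.sqrt n%:R <= #|C|%:R
                                            <= c * Num.sqrt n%:R / eps])
  /\
  (exists N : nat, forall n : nat, (N < n)%N ->
    exists P : {set {set {set 'I_n}}},
      [/\ finset.partition P [set: {set 'I_n}]%SET,
          #|P| = 'C(n, n./2)
        & forall C : {set {set 'I_n}}, C \in P ->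
            rank_symmetric_chain C /\
            8 / 10 * Num.sqrt n%:R <= (#|C|%:R : R) <= 13 * Num.sqrt n%:R]).
Proof.
split.
  (* As eps < [|alpha R| + 1], the bound 10 sqrt n is at most c sqrt n / eps. *)
  exists (10 * (`|alpha R| + 1)); split.
    by rewrite mulr_gt0 // ltr_wpDl.
  move=> eps eps0 eps_alpha; have [K /rank_symmetric_partition[N HN]] := alpha_approx eps0.
  exists N => n Nn; have [P [partP cardP chainP]] := HN n Nn.
  exists P; split=> // C CP; have [symC /andP[lo up]] := chainP C CP.
  split=> //; rewrite lo; apply: le_trans up _.
  rewrite ler_pdivlMr // mulrAC ler_wpM2r ?sqrtr_ge0 // ler_wpM2l //.
  by apply: le_trans (ltW eps_alpha) _; apply: le_trans (ler_norm _) _; rewrite lerDl.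
have [N HN] := rank_symmetric_partition (alpha_sum15_gt R).
exists N => n Nn; have [P [partP cardP chainP]] := HN n Nn.
exists P; split=> // C CP; have [symC /andP[lo up]] := chainP C CP.
split=> //; rewrite lo; apply: le_trans up _.
by rewrite ler_wpM2r ?sqrtr_ge0 // ler_nat.
Qed.
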